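(* Let $k,l\ge 1$, let $T_1\in Y_k$ and $T_2\in Y_l$ be binary trees, and let $C_1=C(T_1)$ and $C_2=C(T_2)$ be their associated Catalan alternative tableaux, of sizes $k-1$ and $l-1$ and shapes $w^1=w^1_1\cdots w^1_{k-1}$ and $w^2=w^2_1\cdots w^2_{l-1}$. Let $\mathcal{C}$ be the set of Catalan alternative tableaux $C$ of size $k+l-1$ such that: (i) the shape of $C$ is $w^1\,s\,w^2$ (concatenation) for some $s\in\{U,D\}$, so that $w^1$ occupies positions $1,\dots,k-1$, the letter $s$ is at position $k$, and $w^2$ occupies positions $k+1,\dots,k+l-1$; (ii) for every cell $(i,j)$ of $C$ with $j\le k-1$, the cell $(i,j)$ carries a dot of a given colour in $C$ if and only if it carries a dot of the same colour in $C_1$; (iii) for every cell $(i,j)$ of $C$ with $i\ge k+1$, the cell $(i,j)$ carries a dot of a given colour in $C$ if and only if the cell $(i-k,j-k)$ carries a dot of the same colour in $C_2$. There is no further condition on the dots in the remaining cells $(i,j)$ with $i\le k\le j$; these cells form a rectangle. Then, in the Loday–Ronco algebra, $$T_1 * T_2=\sum_{C\in\mathcal{C}} T(C),$$ where $T(C)\in Y_{k+l}$ denotes the binary tree associated to $C$ by the bijection $T\mapsto C(T)$ described in the context.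
   Context: Let $k$ be a field. Binary trees are plane (rooted) binary trees: every vertex has an optional left child and an optional right child. $Y_n$ is the set of binary trees with $n$ vertices (the ''internal vertices'' of a complete binary tree), and $k[Y_\infty]=\bigoplus_{n\ge0}k[Y_n]$. The vertices of a tree in $Y_n$ are numbered $1,\dots,n$ in in-order (symmetric order: left subtree, then root, then right subtree). Malvenuto–Reutenauer product. For a word $u=u_1\cdots u_m$ of distinct integers, $\mathrm{Std}(u)$ is the unique permutation $\sigma\in S_m$ with $\sigma_i<\sigma_j\iff u_i<u_j$. For $\sigma\in S_m$ and a set $A$ of $m$ integers, $\sigma_{|A}$ is the word with letter set $A$ and $\mathrm{Std}(\sigma_{|A})=\sigma$. On $k[S_\infty]=\bigoplus_n k[S_n]$ define, for $\sigma\in S_p$ and $\tau\in S_q$, $$\sigma*\tau=\sum_{A\sqcup B=\{1,\dots,p+q\}}\sigma_{|A}\cdot\tau_{|B},$$ where $\cdot$ is concatenation. For $\sigma=\sigma_1\cdots\sigma_n\in S_n$, its increasing binary tree is defined recursively: its root is labelled by the minimum value $m=\sigma_p$; the left subtree is built from $\sigma_1\cdots\sigma_{p-1}$ and the right subtree from $\sigma_{p+1}\cdots\sigma_n$. Reading the labels in in-order gives back $\sigma$. $\Psi(\sigma)\in Y_n$ is the underlying unlabelled tree. For $T\in Y_n$ put $Z_T=\{\sigma\in S_n:\Psi(\sigma)=T\}$ and $\Psi^*(T)=\sum_{\sigma\in Z_T}\sigma$. By a theorem of Loday–Ronco, the linear injection $\Psi^*:k[Y_\infty]\to k[S_\infty]$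 has image closed under $*$. The Loday–Ronco product $T_1*T_2$ is the unique element of $k[Y_\infty]$ with $\Psi^*(T_1*T_2)=\Psi^*(T_1)*\Psi^*(T_2)$. Catalan alternative tableaux. A shape of size $m$ is a word $w=w_1\cdots w_m\in\{U,D\}^m$, where $U$ is a vertical step (the value $+1$) and $D$ is a horizontal step (the value $-1$). Its cells are the pairs $(i,j)$ with $1\le i<j\le m$, $w_i=U$ and $w_j=D$. The cell $(i,j)$ lies in row $i$ and column $j$. A cell $(i',j)$ is said to be below $(i,j)$ if $i'<i$, and a cell $(i,j')$ is to the left of $(i,j)$ if $j'>j$. A Catalan alternative tableau of size $m$ is a shape of size $m$ together with a set of its cells, each carrying a blue or a red dot, such that: (1) no dot lies below a red dot; (2) no dot lies to the left of a blue dot; (3) every cell without a dot is below a red dot or to the left of a blue dot. Bijection with trees. Let $T\in Y_n$ with $n\ge1$, with vertices numbered in in-order. Its shape $w\in\{U,D\}^{n-1}$ is defined by setting $w_i=U$ if vertex $i$ has a right child, and $w_i=D$ otherwise. In the latter case vertex $i+1$ has a left child, and $w$ is the common Up–Down sequence of all $\sigma\in Z_T$. The edge from vertex $i$ to its right child is given index $i$, and the edge from vertex $i+1$ to its left child is given index $i$. For each edge $e$ of $T$, if some edge of the opposite direction (left vs. right) lies on the path from $e$ up to the root, let $f$ be the nearest such edge. Let $i$ be the index of the right edge among $\{e,f\}$ and $j$ the index of the left edge among $\{e,f\}$. Then $(i,j)$ is a cell, and we put in it a blue dot if $e$ is a right edge and a red dot if $e$ is a left edge. The result $C(T)$ is a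 Catalan alternative tableau of size $n-1$, and $T\mapsto C(T)$ is a bijection from $Y_n$ onto the Catalan alternative tableaux of size $n-1$. Its inverse is written $C\mapsto T(C)$. *)

(* Defs.v *)
From HB Require Import structures.
From Stdlib Require Import ClassicalEpsilon.
From mathcomp Require Import all_boot all_fingroup all_algebra.
From mathcomp Require Import finmap.
From mathcomp.multinomials Require Import monalg.

Set Implicit Arguments.
Unset Strict Implicit.
Unset Printing Implicit Defensive.

Import GRing.Theory.
Local Open Scope ring_scope.

(* All positions, vertex numbers, letters of permutations and tableau rows and
   columns are counted from 0: position i here is position i + 1 in the usual
   one-based convention. *)

(** * Binary trees *)

(* [Leaf] is the empty tree, i.e. an absent child. *)
Inductive btree : Type := Leaf | Node of btree & btree.

Fixpoint btree_encode (T : btree) : GenTree.tree unit :=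
  if T is Node L R then GenTree.Node 1 [:: btree_encode L; btree_encode R]
  else GenTree.Node 0 [::].

Fixpoint btree_decode (t : GenTree.tree unit) : btree :=
  if t is GenTree.Node _ [:: l; r] then Node (btree_decode l) (btree_decode r)
  else Leaf.

Lemma btree_encodeK : cancel btree_encode btree_decode.
Proof. by elim=> //= L -> R ->. Qed.

HB.instance Definition _ := Countable.copy btree (can_type btree_encodeK).

Fixpoint nverts (T : btree) : nat :=
  if T is Node L R then (nverts L + nverts R).+1 else 0.

(** * The Malvenuto-Reutenauer product *)

Definition perms : Type := {n : nat & 'S_n}.

Definition perm_word n (s : 'S_n) : seq nat := [seq val (s i) | i <- enum 'I_n].

Definition std (u : seq nat) : seq nat := [seq count (ltn^~ x) u | x <- u].

Definition letters N (A : {set 'I_N}) : seq nat := [seq val a | a <- enum A].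

(* The word s_{|A}; [letters A] is increasing.  See [relabelP]. *)
Definition relabel m N (s : 'S_m) (A : {set 'I_N}) : seq nat :=
  [seq nth 0%N (letters A) x | x <- perm_word s].

(* The inner sum has exactly one term, the permutation with the given word; see
   [mr_word_exists] and [perm_word_inj]. *)
Definition mr_mul_perm (F : fieldType) p q (s : 'S_p) (t : 'S_q) :
    {malg F[perms]} :=
  \sum_(A : {set 'I_(p + q)} | #|A| == p)
    \sum_(r : 'S_(p + q) | perm_word r == relabel s A ++ relabel t (~: A))
      << (existT _ (p + q)%N r : perms) >>.

Definition mr_mul (F : fieldType) (x y : {malg F[perms]}) : {malg F[perms]} :=
  \sum_(s <- msupp x) \sum_(t <- msupp y)
    (x@_s * y@_t) *: mr_mul_perm F (projT2 s) (projT2 t).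

(** * The Loday-Ronco product *)

(* Shape of the increasing binary tree of a word with distinct letters; the
   first argument bounds the recursion depth.  See [inc_treeE]. *)
Fixpoint inc_tree_rec (fuel : nat) (u : seq nat) : btree :=
  match fuel, u with
  | fuel'.+1, _ :: _ =>
      let p := find (fun m => all (leq m) u) u in
      Node (inc_tree_rec fuel' (take p u)) (inc_tree_rec fuel' (drop p.+1 u))
  | _, _ => Leaf
  end.

Definition inc_tree (u : seq nat) : btree := inc_tree_rec (size u) u.

Definition Psi n (s : 'S_n) : btree := inc_tree (perm_word s).

Definition Psi_star_tree (F : fieldType) (T : btree) : {malg F[perms]} :=
  \sum_(s : 'S_(nverts T) | Psi s == T) << (existT _ (nverts T) s : perms) >>.

Definition Psi_star (F : fieldType) (x : {malg F[btree]}) : {malg F[perms]} :=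
  \sum_(T <- msupp x) x@_T *: Psi_star_tree F T.

Definition lr_mul (F : fieldType) (x y : {malg F[btree]}) : {malg F[btree]} :=
  epsilon (inhabits 0)
    (fun z => Psi_star z = mr_mul (Psi_star x) (Psi_star y)).

(** * Catalan alternative tableaux *)

Variant step := U | D.
Definition step_bool s := if s is U then true else false.
Definition bool_step b := if b then U else D.
Lemma step_boolK : cancel step_bool bool_step. Proof. by case. Qed.
HB.instance Definition _ := Finite.copy step (can_type step_boolK).

Variant color := Blue | Red.
Definition color_bool c := if c is Blue then true else false.
Definition bool_color b := if b then Blue else Red.
Lemma color_boolK : cancel color_bool bool_color. Proof. by case. Qed.
HB.instance Definition _ := Finite.copy color (can_type color_boolK).

(* A shape of size m together with an optional coloured dot at each (i, j). *)
Definition filling (m : nat) : Type :=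
  (m.-tuple step * {ffun 'I_m * 'I_m -> option color})%type.

Definition tshape m (C : filling m) : m.-tuple step := C.1.

Definition cell m (w : m.-tuple step) (i j : 'I_m) : bool :=
  [&& (i < j)%N, tnth w i == U & tnth w j == D].

(* Indices of type nat make fillings of different sizes comparable; there is no
   dot outside the range. *)
Definition dot m (C : filling m) (i j : nat) : option color :=
  match insub i, insub j with
  | Some i', Some j' => C.2 (i', j')
  | _, _ => None
  end.

Definition catalan m (C : filling m) : bool :=
  [&& [forall i : 'I_m, forall j : 'I_m,
         (dot C i j != None) ==> cell (tshape C) i j],
      [forall i : 'I_m, forall j : 'I_m, forall i' : 'I_m,
         (dot C i j == Some Red) && (i' < i)%N ==> (dot C i' j == None)],
      [forall i : 'I_m, forall j : 'I_m, forall j' : 'I_m,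
         (dot C i j == Some Blue) && (j < j')%N ==> (dot C i j' == None)]
    & [forall i : 'I_m, forall j : 'I_m,
         cell (tshape C) i j && (dot C i j == None) ==>
           [exists i' : 'I_m, (i < i')%N && (dot C i' j == Some Red)]
           || [exists j' : 'I_m, (j' < j)%N && (dot C i j' == Some Blue)]]].

(** * The bijection with trees *)

Variant dir := ToLeft | ToRight.
Definition dir_bool d := if d is ToLeft then true else false.
Definition bool_dir b := if b then ToLeft else ToRight.
Lemma dir_boolK : cancel dir_bool bool_dir. Proof. by case. Qed.
HB.instance Definition _ := Finite.copy dir (can_type dir_boolK).

(* Direction and index of an edge. *)
Definition edge : Type := (dir * nat)%type.

(* One entry per edge of T: the list of the edges met when going from that edge
   (included, first) up to the root.  Here T is a subtree whose vertices are
   numbered from [o] on, and [anc] lists the edges above it, nearest first. *)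
Fixpoint edge_paths (T : btree) (o : nat) (anc : seq edge) : seq (seq edge) :=
  if T is Node L R then
    let v := (o + nverts L)%N in
    let el := (ToLeft, v.-1) :: anc in
    let er := (ToRight, v) :: anc in
    (if L is Leaf then [::] else el :: edge_paths L o el) ++
    (if R is Leaf then [::] else er :: edge_paths R v.+1 er)
  else [::].

Definition path_dot (p : seq edge) : option (nat * nat * color) :=
  if p is e :: anc then
    if [seq f <- anc | f.1 != e.1] is f :: _ then
      if e.1 is ToRight then Some (e.2, f.2, Blue) else Some (f.2, e.2, Red)
    else None
  else None.

Definition tree_dots (T : btree) : seq (nat * nat * color) :=
  pmap path_dot (edge_paths T 0 [::]).

(* In-order list of the letters saying whether each vertex has a right child. *)
Fixpoint right_steps (T : btree) : seq step :=
  if T is Node L R then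
    right_steps L ++ (if R is Leaf then D else U) :: right_steps R
  else [::].

(* Meaningful for nverts T = m.+1; the last vertex contributes no letter. *)
Definition tableau_of_tree (m : nat) (T : btree) : filling m :=
  ([tuple nth D (right_steps T) i | i < m],
   [ffun ij : 'I_m * 'I_m =>
      [pick c : color | (val ij.1, val ij.2, c) \in tree_dots T]]).

Definition tree_of_tableau (m : nat) (C : filling m) : btree :=
  epsilon (inhabits Leaf) (fun T => nverts T = m.+1 /\ tableau_of_tree m T = C).

(** * The tableaux occurring in a product *)

Definition product_tableaux (k l : nat)
    (C1 : filling k.-1) (C2 : filling l.-1) : {set filling (k + l).-1} :=
  [set C : filling (k + l).-1 |
    [&& catalan C,
        [exists s : step, (tshape C : seq step) == tshape C1 ++ s :: tshape C2],
        [forall i : 'I_(k + l).-1, forall j : 'I_(k + l).-1,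
           cell (tshape C) i j && (j < k.-1)%N ==> (dot C i j == dot C1 i j)]
      & [forall i : 'I_(k + l).-1, forall j : 'I_(k + l).-1,
           cell (tshape C) i j && (k <= i)%N ==>
             (dot C i j == dot C2 (i - k) (j - k))]]].

(** * Facts justifying the encodings above *)

Lemma perm_word_inj n : injective (@perm_word n).
Proof.
move=> s t /eq_in_map H; apply/permP=> i; apply: val_inj; apply: H.
by rewrite mem_enum.
Qed.

Lemma size_perm_word n (s : 'S_n) : size (perm_word s) = n.
Proof. by rewrite size_map size_enum_ord. Qed.

Lemma perm_word_iota n (s : 'S_n) : perm_eq (perm_word s) (iota 0 n).
Proof.
apply: uniq_perm; rewrite ?iota_uniq //.
  by rewrite map_inj_uniq ?enum_uniq // => i j /val_inj/perm_inj.
move=> x; rewrite mem_iota add0n leq0n; apply/mapP/idP => [[i _ ->]|lt_xn].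
  exact: ltn_ord.
by exists (s^-1 (Ordinal lt_xn))%g; rewrite ?mem_enum // permKV.
Qed.

Lemma letters_sorted N (A : {set 'I_N}) : sorted ltn (letters A).
Proof.
have -> : letters A = map val (filter (mem A) (enum 'I_N)).
  by rewrite /letters [in RHS]enumT.
have: sorted ltn (map val (enum 'I_N)) by rewrite val_enum_ord iota_ltn_sorted.
have tr : transitive (relpre (val : 'I_N -> nat) ltn).
  by move=> y x z; exact: ltn_trans.
by move: (enum _) => e; rewrite !sorted_map; exact: sorted_filter.
Qed.

Lemma relabel_perm m N (s : 'S_m) (A : {set 'I_N}) :
  #|A| = m -> perm_eq (relabel s A) (letters A).
Proof.
move=> cA; apply: perm_trans (perm_map _ (perm_word_iota s)) _.
have szA : size (letters A) = m by rewrite size_map -cardE.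
by rewrite -/(mkseq _ _) -[in mkseq _ _]szA mkseq_nth.
Qed.

Lemma relabelP m N (s : 'S_m) (A : {set 'I_N}) : #|A| = m ->
  perm_eq (relabel s A) (letters A) /\ std (relabel s A) = perm_word s.
Proof.
move=> cA; have pA := relabel_perm s cA; split=> //.
have szA : size (letters A) = m by rewrite size_map -cardE.
rewrite /std {2}/relabel -map_comp -[RHS]map_id; apply/eq_in_map => x.
rewrite (perm_mem (perm_word_iota s)) mem_iota add0n /= => lt_xm.
rewrite (seq.permP pA) /=; set L := letters A in szA *.
have homo i j : (i < j)%N -> (j < m)%N -> (nth 0 L i < nth 0 L j)%N.
  move=> lt_ij lt_jm; apply: (sorted_ltn_nth ltn_trans 0%N (letters_sorted A));
    by rewrite ?inE ?szA // (ltn_trans lt_ij).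
have mono i : (i < m)%N -> (nth 0 L i < nth 0 L x)%N = (i < x)%N.
  move=> lt_im; case: (ltngtP i x) => [lt_ix|lt_xi|->]; rewrite ?ltnn //.
    exact: homo.
  by apply/negbTE; rewrite -leqNgt ltnW // homo.
have cE y : count (ltn^~ y) L = count (fun i => nth 0 L i < y)%N (iota 0 m).
  by rewrite -{1}(mkseq_nth 0%N L) szA count_map.
apply: (etrans (cE _)); rewrite (eq_in_count (a2 := ltn^~ x)); last first.
  by move=> i; rewrite mem_iota add0n; exact: mono.
rewrite -(subnKC (ltnW lt_xm)) iotaD count_cat add0n.
rewrite (eq_in_count (a2 := predT)); last by move=> i; rewrite mem_iota.
rewrite (eq_in_count (a1 := ltn^~ x) (a2 := pred0)); last first.
  by move=> i; rewrite mem_iota => /andP[le_xi _]; rewrite /= ltnNge le_xi.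
by rewrite count_predT count_pred0 size_iota addn0.
Qed.

Lemma mr_word_exists p q (s : 'S_p) (t : 'S_q) (A : {set 'I_(p + q)}) :
  #|A| = p ->
  exists r : 'S_(p + q), perm_word r = relabel s A ++ relabel t (~: A).
Proof.
move=> cA; set w := _ ++ _.
have cB : #|~: A| = q by rewrite cardsCs setCK card_ord cA addKn.
have pw : perm_eq w (letters A ++ letters (~: A)).
  exact: perm_cat (relabel_perm _ cA) (relabel_perm _ cB).
have sw : size w = (p + q)%N.
  by rewrite size_cat !size_map -!enumT !size_enum_ord.
have uw : uniq w.
  rewrite (perm_uniq pw) -map_cat map_inj_uniq; last exact: val_inj.
  rewrite cat_uniq !enum_uniq andbT /=; apply/hasPn => x.
  by rewrite !mem_enum inE.
have lw i : (i < p + q)%N -> (nth 0 w i < p + q)%N.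
  move=> lti; have: nth 0%N w i \in w by rewrite mem_nth ?sw.
  by rewrite (perm_mem pw) -map_cat => /mapP[x _ ->]; exact: ltn_ord.
pose f (i : 'I_(p + q)) : 'I_(p + q) := Ordinal (lw i (ltn_ord i)).
have fI : injective f.
  by move=> i j [] /eqP; rewrite nth_uniq ?sw // => /eqP/val_inj.
exists (perm fI); apply: (@eq_from_nth _ 0%N); rewrite ?size_perm_word ?sw //.
move=> i lti; rewrite (nth_map (Ordinal lti)) ?size_enum_ord // permE /=.
by rewrite nth_enum_ord.
Qed.

Lemma inc_tree_rec_fuel a b u : (size u <= a)%N -> (size u <= b)%N ->
  inc_tree_rec a u = inc_tree_rec b u.
Proof.
elim: a b u => [|a IH] [|b] [|x u] // lea leb.
rewrite /inc_tree_rec -/inc_tree_rec; move uE : (x :: u) lea leb => v lea leb.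
set p := find _ _; have lt_p : (p < size v)%N.
  rewrite -has_find; apply/hasP; rewrite -uE.
  have [m mu mle] := @ex_minnP (mem (x :: u)) (ex_intro _ x (mem_head x u)).
  by exists m => //; apply/allP => y /mle.
have lt_d : (size v - p.+1 < size v)%N.
  by rewrite ltn_subrL ltn0Sn (leq_ltn_trans (leq0n p)).
congr Node; apply: IH; rewrite ?size_drop ?size_take ?lt_p -ltnS;
  by [apply: leq_trans lt_p _ | apply: leq_trans lt_d _].
Qed.

Lemma inc_treeE (u1 u2 : seq nat) m :
  all (leq m.+1) (u1 ++ u2) ->
  inc_tree (u1 ++ m :: u2) = Node (inc_tree u1) (inc_tree u2).
Proof.
move=> /allP h; rewrite /inc_tree size_cat /= addnS.
have fE : find (fun x => all (leq x) (u1 ++ m :: u2)) (u1 ++ m :: u2) = size u1.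
  rewrite find_cat /=; case: ifP => [/hasP[x xu1 /allP/(_ m)]|_].
    rewrite mem_cat mem_head orbT leqNgt => /(_ isT).
    by rewrite h // mem_cat xu1.
  rewrite ifT ?addn0 //; apply/allP => y; rewrite mem_cat in_cons.
  case/or3P => [y1|/eqP->//|y2]; apply: ltnW; apply: h;
    by rewrite mem_cat ?y1 ?y2 ?orbT.
case uE : (u1 ++ m :: u2) => [|z v]; first by case: (u1) uE.
rewrite -uE; have -> n : inc_tree_rec n.+1 (u1 ++ m :: u2) =
  Node (inc_tree_rec n (take (size u1) (u1 ++ m :: u2)))
       (inc_tree_rec n (drop (size u1).+1 (u1 ++ m :: u2))).
  by rewrite -{1 2}fE uE.
rewrite take_size_cat // drop_cat ltnNge leqnSn /= subSnn /= drop0.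
by congr Node; apply: inc_tree_rec_fuel; rewrite ?leq_addr ?leq_addl.
Qed.

Lemma dotE m (C : filling m) (i j : 'I_m) : dot C i j = C.2 (i, j).
Proof. by rewrite /dot !valK. Qed.

(* Main.v *)
Require Import Defs.
From Stdlib Require Import ClassicalEpsilon.
From mathcomp Require Import all_boot all_fingroup all_algebra.
From mathcomp Require Import finmap zify.
From mathcomp.multinomials Require Import monalg.

(** Everything is read off words.  If T is the increasing tree of a word u, then
    the shape of C(T) is the up-down sequence of u, and whether the cell (i, j)
    carries a dot, and of which colour, is decided by the factor u_i ...
      u_(j+1).
    Hence the cells with j < k - 1, resp. i >= k, of the tableau of u form the
    tableau of the prefix of length k, resp. of the complementary suffix.  On
      the
    other hand the product of Psi^*(T1) and Psi^*(T2) is the sum of the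
    permutations whose prefix of length k has tree T1 and whose suffix has tree
    T2, so the theorem follows from the bijectivity of T |-> C(T).

    Injectivity: the position of the minimum of u, i.e. the root, can be found
    from the tableau.  Surjectivity: in a Catalan tableau every column without a
    red dot lies before every row without a blue dot, and the root sits between
    them; the dots outside the two subtableaux it cuts out are then forced. *)

Set Implicit Arguments.
Unset Strict Implicit.
Unset Printing Implicit Defensive.

Import GRing.Theory.

(** * Words and Catalan tableaux *)

Definition inj_on (a b : nat) (f : nat -> nat) :=
  forall i j, a <= i < b -> a <= j < b -> f i = f j -> i = j.

(* A word is a function f, used on the positions a, ..., b - 1 where it is
   injective.  The tableau of its increasing tree is local: the cell (i, j) only
   depends on the values of f at i, ..., j + 1.  It carries a dot when i < j and
   f i, f (j + 1) are both smaller than everything strictly in between; the dot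
   is red if f i < f (j + 1) and blue otherwise. *)
Definition wup (f : nat -> nat) i := if f i < f i.+1 then U else D.

Definition wred (f : nat -> nat) i j :=
  [&& i < j, f i < f j.+1 & [forall t : 'I_j.+1, (i < t) ==> (f j.+1 < f t)]].

Definition wblue (f : nat -> nat) i j :=
  [&& i < j, f j.+1 < f i & [forall t : 'I_j.+1, (i < t) ==> (f i < f t)]].

Definition wdot f i j :=
  if wred f i j then Some Red else if wblue f i j then Some Blue else None.

Lemma wredP f i j :
  reflect [/\ i < j, f i < f j.+1 & forall t, i < t <= j -> f j.+1 < f t]
          (wred f i j).
Proof.
apply: (iffP and3P) => -[ij fij h]; split=> //.
  by move=> t /andP[it tj];
    exact: (implyP (forallP h (Ordinal (tj : t < j.+1)))).
apply/forallP => -[t tj]; apply/implyP => /= it; apply: h; lia.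
Qed.

Lemma wblueP f i j :
  reflect [/\ i < j, f j.+1 < f i & forall t, i < t <= j -> f i < f t]
          (wblue f i j).
Proof.
apply: (iffP and3P) => -[ij fij h]; split=> //.
  by move=> t /andP[it tj];
    exact: (implyP (forallP h (Ordinal (tj : t < j.+1)))).
apply/forallP => -[t tj]; apply/implyP => /= it; apply: h; lia.
Qed.

Lemma wup_U f i : wup f i = U <-> f i < f i.+1.
Proof. by rewrite /wup; case: ifP => _; split. Qed.

Lemma wup_D f i : wup f i = D <-> f i.+1 <= f i.
Proof. by rewrite /wup (leqNgt (f i.+1)); case: ifP => _; split. Qed.

Lemma wdot_Red f i j : wdot f i j = Some Red <-> wred f i j.
Proof. by rewrite /wdot; case: ifP => _ //; case: ifP. Qed.

Lemma wdot_Blue f i j : wdot f i j = Some Blue <-> wblue f i j.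
Proof.
rewrite /wdot; case: ifP => [/wredP[_ lt1 _]|_]; last by case: ifP => _; split.
by split=> // /wblueP[_]; lia.
Qed.

Lemma wdot_ext f g a b i j :
  (forall s t, a <= s < b -> a <= t < b -> (f s < f t) = (g s < g t)) ->
  a <= i -> j.+1 < b -> wdot f i j = wdot g i j.
Proof.
move=> e ai jb; case: (ltnP i j) => [ij|]; last first.
  by move=> ji; rewrite /wdot /wred /wblue ltnNge ji.
have E : forall t : 'I_j.+1, (i < t) ==> (f j.+1 < f t) = (i < t) ==> (g j.+1
  < g t).
  by case=> t tj; case: ltnP => //= it; apply: e; lia.
have E' : forall t : 'I_j.+1, (i < t) ==> (f i < f t) = (i < t) ==> (g i < g t).
  by case=> t tj; case: ltnP => //= it; apply: e; lia.
by rewrite /wdot /wred /wblue (eq_forallb E) (eq_forallb E') !e //; lia.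
Qed.

Lemma wup_ext f g a b i :
  (forall s t, a <= s < b -> a <= t < b -> (f s < f t) = (g s < g t)) ->
  a <= i -> i.+1 < b -> wup f i = wup g i.
Proof. by move=> e ai ib; rewrite /wup e //; lia. Qed.

(* The nearest smaller value to the left of a descent carries a red dot. *)
Lemma wred_column f a b p j : inj_on a b f -> a <= p -> p < j -> j.+1 < b ->
  f p < f j.+1 -> f j.+1 <= f j -> exists2 i, p <= i < j & wred f i j.
Proof.
move=> fI ap pj jb lt_p le_j.
pose P t := (p <= t <= j) && (f t < f j.+1).
have exP : exists t, P t by exists p; rewrite /P lt_p; lia.
have ubP t : P t -> t <= j by rewrite /P; lia.
case: (ex_maxnP exP ubP) => i /andP[/andP[pi ij] lti] mi.
(* The descent at [j] excludes [i = j]. *)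
have ij' : i < j by case: (ltngtP i j) lti => // [|->]; lia.
exists i; first lia.
apply/wredP; split=> // t /andP[it tj].
have := mi t; rewrite /P => h.
case: (ltngtP (f t) (f j.+1)) => // [lt|/fI]; last by lia.
by move: h; rewrite lt; lia.
Qed.

(** Mirror image of [wred_column]: the first value after [i] below [f i] sits at [j + 1], and the
    ascent at [i] keeps it away from [i + 1]. *)
Lemma wblue_row f a b i p : inj_on a b f -> a <= i -> i.+1 < p -> p < b ->
  f p < f i -> f i <= f i.+1 -> exists2 j, i < j < p & wblue f i j.
Proof.
move=> fI ai ip pb lt_p le_i.
pose P t := (i < t <= p) && (f t < f i).
have exP : exists t, P t by exists p; rewrite /P lt_p; lia.
case: (ex_minnP exP) => -[|j] /andP[/andP[ij jp] ltj] mj //.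
have ij' : i < j.
  by have [//|ji|e] := ltngtP i j; [lia | move: ltj; rewrite -e; lia].
exists j; first lia.
apply/wblueP; split=> // t /andP[it tj].
have := mj t; rewrite /P => h.
case: (ltngtP (f t) (f i)) => // [lt|/fI]; last by lia.
by move: h; rewrite lt; lia.
Qed.

(* The tableau is read on the vertices a, ..., b - 1, i.e. on the positions i
   with a <= i and i + 1 < b. *)
Record cat_on (w : nat -> step) (d : nat -> nat -> option color) (a b : nat) :
    Prop := CatOn {
  cat_cell : forall i j, a <= i -> i.+1 < b -> a <= j -> j.+1 < b ->
    d i j <> None -> [/\ i < j, w i = U & w j = D];
  cat_red : forall i i' j, a <= i' -> i' < i -> i.+1 < b -> a <= j ->
    j.+1 < b ->
    d i j = Some Red -> d i' j = None;
  cat_blue : forall i j j', a <= i -> i.+1 < b -> a <= j -> j < j' ->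
    j'.+1 < b ->
    d i j = Some Blue -> d i j' = None;
  cat_full : forall i j, a <= i -> i < j -> j.+1 < b -> w i = U -> w j = D ->
    d i j = None ->
    (exists2 i', i < i' < j & d i' j = Some Red) \/
    (exists2 j', i < j' < j & d i j' = Some Blue)
}.

(** The dots that witness fullness of a cell [(i, j)] lie strictly between [i] and [j], so all
    conditions survive on a smaller interval. *)
Lemma cat_on_sub w d a b a' b' : a <= a' -> b' <= b ->
  cat_on w d a b -> cat_on w d a' b'.
Proof.
move=> aa bb [h1 h2 h3 h4]; split.
- by move=> i j *; apply: h1 => //; lia.
- by move=> i i' j ? ? ? ? ?; apply: h2; lia.
- by move=> i j j' ? ? ? ? ?; apply: h3; lia.
- by move=> i j ? ? ?; apply: h4; lia.
Qed.

Lemma cat_on_ext w d w' d' a b :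
  (forall i, a <= i -> i.+1 < b -> w i = w' i) ->
  (forall i j, a <= i -> i.+1 < b -> a <= j -> j.+1 < b -> d i j = d' i j) ->
  cat_on w d a b -> cat_on w' d' a b.
Proof.
move=> ew ed [h1 h2 h3 h4]; split.
- by move=> i j *; rewrite -!ew // ; apply: h1; rewrite ?ed.
- by move=> i i' j ? ? ? ? ?; rewrite -!ed //; try lia; apply: h2; lia.
- by move=> i j j' ? ? ? ? ?; rewrite -!ed //; try lia; apply: h3; lia.
- move=> i j ? ? ?; rewrite -!ew -?ed; try lia; move=> wi wj dij.
  case: (h4 i j) => //; case=> [t ti dt]; [left|right]; exists t => //.
  by rewrite -ed //; lia.
  by rewrite -ed //; lia.
Qed.

(** For fullness, compare the two ends of the factor. If [f i] is the smaller one, the nearest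
    smaller value left of [j + 1] gives a red dot in column [j]; otherwise the first value below
    [f i] gives a blue dot in row [i]. Neither is the cell itself, which is empty. *)
Lemma cat_on_word f a b : inj_on a b f -> cat_on (wup f) (wdot f) a b.
Proof.
move=> fI; split.
- move=> i j ai ib aj jb; case e : (wdot f i j) => [[]|] // _.
    move/wdot_Blue/wblueP: e => [ij lt h].
    by split=> //; [apply/wup_U; have := h i.+1 | apply/wup_D; have := h j];
      lia.
  move/wdot_Red/wredP: e => [ij lt h].
  by split=> //; [apply/wup_U; have := h i.+1 | apply/wup_D; have := h j]; lia.
- move=> i i' j ai' i'i ib aj jb /wdot_Red/wredP[ij lt h].
  case e : (wdot f i' j) => [[]|] //.
    by move/wdot_Blue/wblueP: e => [_ lt' h']; have := h' i; lia.
  by move/wdot_Red/wredP: e => [_ lt' h']; have := h' i; lia.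
- move=> i j j' ai ib aj jj' jb /wdot_Blue/wblueP[ij lt h].
  case e : (wdot f i j') => [[]|] //.
    by move/wdot_Blue/wblueP: e => [_ lt' h']; have := h' j.+1; lia.
  by move/wdot_Red/wredP: e => [_ lt' h']; have := h' j.+1; lia.
- move=> i j ai ij jb /wup_U wi /wup_D wj dij.
  case: (ltngtP (f i) (f j.+1)) => [lt|lt|/fI]; last by lia.
    left; have [i' /andP[ii' i'j] red] := wred_column fI ai ij jb lt wj.
    exists i'; last exact/wdot_Red.
    rewrite i'j andbT ltn_neqAle ii' andbT; apply/eqP => e.
    by move: dij; rewrite e (iffRL (wdot_Red _ _ _) red).
  right; have [|||||j' /andP[ij']] // := @wblue_row f a b i j.+1 fI; try lia.
  rewrite ltnS => j'j bl; exists j'; last exact/wdot_Blue.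
  rewrite ij' /= ltn_neqAle j'j andbT; apply/eqP => e.
  by move: dij; rewrite -e (iffRL (wdot_Blue _ _ _) bl).
Qed.

(* The root of the tree of a tableau is the vertex v between the last column
   without a red dot and the first row without a blue dot. *)
Definition cat_root (w : nat -> step) d a b v :=
  [/\ a <= v < b,
      a < v -> w v.-1 = D /\ forall i, a <= i < v.-1 -> d i v.-1 <> Some Red
    & v.+1 < b -> w v = U /\ forall j, v < j -> j.+1 < b -> d v j <> Some Blue].

(* The rows below a column without red dots are already stopped by a blue dot
   when they reach that column. *)
Lemma free_column_blocks w d a b c i j : cat_on w d a b ->
  (forall i, a <= i < c -> d i c <> Some Red) -> w c = D ->
  a <= i < c -> w i = U -> c < j -> j.+1 < b -> d i j = None.
Proof.
move=> cd nred wc /andP[ai ic] wi cj jb.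
case e : (d i c) => [[]|]; last first.
- case: (cat_full cd ai ic _ wi wc e); first lia.
    by case=> i' ? /nred; lia.
  by case=> j' ? h; apply: (cat_blue cd _ _ _ _ _ h); lia.
- by move/nred: e; lia.
- by apply: (cat_blue cd _ _ _ _ _ e); lia.
Qed.

(** Let [v] be maximal such that [v = a] or column [v - 1] has no red dot. All later columns then
    have a red dot, while the rows before [v] have no dots there; so neither [w v = D] nor a blue
    dot in row [v] is possible. *)
Lemma cat_root_exists w d a b : cat_on w d a b -> a < b ->
  exists v, cat_root w d a b v.
Proof.
move=> cd ab.
pose fc c := (w c == D) && [forall i : 'I_c, (a <= i) ==> (d i c != Some Red)].
have fcP c : reflect (w c = D /\ forall i, a <= i < c ->
  d i c <> Some Red) (fc c).
  apply: (iffP andP) => -[/eqP wc h]; split=> //; try exact/eqP.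
    by move=> i /andP[ai ic]; have /implyP/(_ ai)/eqP := forallP h (Ordinal ic).
  by apply/forallP => -[i ic] /=; apply/implyP => ai; apply/eqP/h; lia.
pose P v := (a <= v < b) && ((v == a) || fc v.-1).
have exP : exists v, P v by exists a; rewrite /P eqxx; lia.
have ubP v : P v -> v <= b by rewrite /P; lia.
case: (ex_maxnP exP ubP) => v /andP[vab vP] mv.
have nfc c : v <= c -> c.+1 < b -> w c = D ->
    exists2 i, a <= i < c & d i c = Some Red.
  move=> vc cb wc; have := mv c.+1; rewrite /P /=.
  have -> : (c.+1 == a) = false by apply/eqP; lia.
  case e : (fc c) => /= h; first lia.
  move/negbT: e; rewrite /fc wc eqxx /= negb_forall => /existsP[[i ic]] /=.
  by rewrite negb_imply negbK => /andP[ai /eqP e]; exists i => //; lia.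
have fv : a < v -> w v.-1 = D /\ forall i, a <= i < v.-1 ->
  d i v.-1 <> Some Red.
  by case/orP: vP => [/eqP->|/fcP]; rewrite ?ltnn.
have blk i j : a <= i < v -> w i = U -> v <= j -> j.+1 < b -> d i j = None.
  move=> iv wi vj jb; have [|wc nr] := fv; first lia.
  have ne : i <> v.-1 by move=> e; move: wi; rewrite e wc.
  by apply: (free_column_blocks cd nr wc _ wi) => //; lia.
exists v; split=> // vb.
have wv : w v = U.
  case e : (w v) => //; have [i iv r] := nfc v (leqnn v) vb e.
  have [||||| _ wi _] := cat_cell cd (i := i) (j := v); rewrite ?r //; try lia.
  by move: r; rewrite blk //; lia.
(* The red dot of column [j] cannot be in a row [i < v], which is blocked; for [i > v] it would
   forbid the blue dot, and for [i = v] the colours clash. *)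
split=> // j vj jb bl.
have [||||| _ _ wj] := cat_cell cd (i := v) (j := j); rewrite ?bl //; try lia.
have [|i ij r] := nfc j _ jb wj; first lia.
case: (ltngtP i v) => [iv|vi|e].
- have [||||| _ wi _] := cat_cell cd (i := i) (j := j); rewrite ?r //; try lia.
  by move: r; rewrite blk //; lia.
- have : d v j = None by apply: (cat_red cd _ vi _ _ jb r); lia.
  by rewrite bl.
- by move: r; rewrite e bl.
Qed.

(** The cells with [i < v <= j] are empty behind the free column [v - 1]. Column [v - 1] has only
    blue dots and row [v] only red ones, and there fullness decides each cell from the dots on the
    corresponding side of [v]. *)
Lemma cat_root_unique w d d' a b v :
  cat_on w d a b -> cat_on w d' a b ->
  cat_root w d a b v -> cat_root w d' a b v ->
  (forall i j, a <= i -> i < j -> j.+1 < v -> d i j = d' i j) ->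
  (forall i j, v < i -> i < j -> j.+1 < b -> d i j = d' i j) ->
  forall i j, a <= i -> i.+1 < b -> a <= j -> j.+1 < b -> d i j = d' i j.
Proof.
move=> cd cd' [vab r1 r2] [_ r1' r2'] eL eR i j ai ib aj jb.
have noncell e : cat_on w e a b -> ~ [/\ i < j, w i = U & w j = D] ->
  e i j = None.
  move=> ce nc; case E : (e i j) => [c|] //; case: nc.
  by apply: (cat_cell ce); rewrite ?E.
have [[ij wi wj]|nc] :
  [/\ i < j, w i = U & w j = D] \/ ~ [/\ i < j, w i = U & w j = D].
- case: (ltnP i j) => [ij|]; last by right=> -[]; lia.
  by case: (w i); case: (w j); [right=> -[]|left|right=> -[]|right=> -[]].
- case: (ltngtP j.+1 v) => [jv|vj|jv]; first exact: eL.
    case: (ltngtP i v) => [iv|vi|iv]; first 1 last.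
    + exact: eR.
    + subst i; have [//|wv nb] := r2; have [//|_ nb'] := r2'.
      have E e e' : cat_on w e a b -> cat_on w e' a b ->
        (forall j, v < j -> j.+1 < b -> e v j <> Some Blue) ->
        (forall j, v < j -> j.+1 < b -> e' v j <> Some Blue) ->
        (forall i j, v < i -> i < j -> j.+1 < b -> e i j = e' i j) ->
        e v j = Some Red -> e' v j = Some Red.
        move=> ce ce' ne ne' eq ed.
        case E' : (e' v j) => [[]|] //; first by move/ne': E'; lia.
        case: (cat_full ce' ai ij jb wi wj E').
          move=> [t tj h]; suff : e v j = None by rewrite ed.
          by apply: (cat_red ce (i := t)); rewrite ?eq //; lia.
        by move=> [t tj] /ne'; lia.
      case e1 : (d v j) => [[]|]; first by move/nb: e1; lia.
        by rewrite (E d d').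
      case e2 : (d' v j) => [[]|] //; first by move/nb': e2; lia.
      by rewrite -e1 (E d' d) // => *; rewrite eR.
    + have ne : i <> v.-1 by move=> e; case: r1 => [|h _];
      [lia | rewrite -e wi in h].
      have ne' : j <> v by move=> e; case: r2 => [|h _];
        [lia | rewrite -e wj in h].
      have [|wc nr] := r1; first lia.
      have [|_ nr'] := r1'; first lia.
      rewrite (free_column_blocks cd nr wc _ wi) //; try lia.
      by rewrite (free_column_blocks cd' nr' wc _ wi) //; lia.
  have jE : v.-1 = j by rewrite -jv.
  have [|wc nr] := r1; first lia.
  have [|_ nr'] := r1'; first lia.
  rewrite jE in nr nr'.
  have E e e' : cat_on w e a b -> cat_on w e' a b ->
    (forall i, a <= i < j -> e i j <> Some Red) ->
    (forall i, a <= i < j -> e' i j <> Some Red) ->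
    (forall i j, a <= i -> i < j -> j.+1 < v -> e i j = e' i j) ->
    e i j = Some Blue -> e' i j = Some Blue.
    move=> ce ce' ne ne' eq ed.
    case E' : (e' i j) => [[]|] //; first by move/ne': E'; lia.
    case: (cat_full ce' ai ij jb wi wj E').
      by move=> [t tj] /ne'; lia.
    move=> [t tj h]; suff : e i j = None by rewrite ed.
    by apply: (cat_blue ce (j := t)); rewrite ?eq //; lia.
  case e1 : (d i j) => [[]|].
    by rewrite (E d d').
    by move/nr: e1; lia.
  case e2 : (d' i j) => [[]|] //; last by move/nr': e2; lia.
  by rewrite -e1 (E d' d) // => *; rewrite eL.
- by rewrite !noncell.
Qed.

(** Induction on the length of the interval: words for the tableaux on the two sides of the root are
    glued around a new minimum placed at the root. *)
Lemma cat_on_realized w d n a b : b - a <= n -> cat_on w d a b ->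
  exists f, [/\ inj_on a b f, forall i, a <= i -> i.+1 < b -> wup f i = w i &
    forall i j, a <= i -> i.+1 < b -> a <= j -> j.+1 < b -> wdot f i j = d i j].
Proof.
elim: n => [|n IH] in a b *.
  by move=> le0 _; exists id; split=> [i j|i|i j] *; lia.
move=> ban cd; case: (ltnP a b) => [ab|ba]; last first.
  by exists id; split=> [i j|i|i j] *; lia.
have [v rv] := cat_root_exists cd ab; have [/andP[av vb] r1 r2] := rv.
have [|| fL [iL wL dL]] := IH a v; first lia.
  by apply: cat_on_sub cd => //; lia.
have [|| fR [iR wR dR]] := IH v.+1 b; first lia.
  by apply: cat_on_sub cd => //; lia.
(* The value 0 makes [v] the minimum; odd values on the left and positive even ones on the right
   keep [f] injective and preserve the order on each side. *)
pose f t := if t < v then (fL t).*2.+1 else if t == v then 0 else (fR t).*2.+2.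
have fLE t : t < v -> f t = (fL t).*2.+1 by rewrite /f => ->.
have fvE : f v = 0 by rewrite /f ltnn eqxx.
have fRE t : v < t -> f t = (fR t).*2.+2.
  by move=> vt; rewrite /f ltnNge ltnW //= gtn_eqF.
have fltL s t : a <= s < v -> a <= t < v -> (f s < f t) = (fL s < fL t).
  by move=> *; rewrite !fLE; lia.
have fltR s t : v.+1 <= s < b -> v.+1 <= t < b -> (f s < f t) = (fR s < fR t).
  by move=> *; rewrite !fRE; lia.
have fI : inj_on a b f.
  move=> i j ib jb; have := (fLE i, fLE j); have := (fRE i, fRE j).
  move=> [Ri Rj] [Li Lj]; have := iL i j; have := iR i j.
  have [iv|vi|->] := ltngtP i v; have [jv|vj|->] := ltngtP j v => //;
    rewrite ?fvE; lia.
have fw i : a <= i -> i.+1 < b -> wup f i = w i.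
  move=> ai ib; case: (ltngtP i.+1 v) => [iv|vi|iv].
  - by rewrite -wL //; apply: (wup_ext fltL).
  - case: (ltngtP i v) => [iv|vi'|e]; first lia.
      by rewrite -wR //; apply: (wup_ext fltR).
    subst i; have [//|-> _] := r2.
    by apply/wup_U; rewrite fvE fRE.
  have [|h _] := r1; first lia.
  rewrite -iv /= in h; rewrite h; apply/wup_D; by rewrite iv fvE.
have cf : cat_on w (wdot f) a b by apply: cat_on_ext (cat_on_word fI).
exists f; split=> //; apply: (cat_root_unique cf cd _ rv).
(* A red dot in column [v - 1] or a blue dot in row [v] would need a value below [f v = 0]. *)
- split; first by rewrite av.
    move=> av'; have [//|h _] := r1; split=> // i /andP[ai iv].
    by move/wdot_Red/wredP => [_]; rewrite prednK ?fvE //; lia.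
  move=> vb'; have [//|h _] := r2; split=> // j vj jb.
  by move/wdot_Blue/wblueP => [_]; rewrite fvE.
- move=> i j ai ij jv; rewrite -dL //; try lia.
  exact: (wdot_ext fltL).
- move=> i j vi ij jb; rewrite -dR //; try lia.
  exact: (wdot_ext fltR).
Qed.

(** * Increasing trees of words *)

(** [T] is the increasing tree of the values of [f] from position [o] on, expressed without cutting
    [f] into words. *)
Fixpoint is_tree (f : nat -> nat) (o : nat) (T : btree) : Prop :=
  if T is Node L R then
    let v := o + nverts L in
    [/\ is_tree f o L, is_tree f v.+1 R &
        forall t, o <= t < o + nverts T -> t != v -> f v < f t]
  else True.

Lemma nverts_Node L R : nverts (Node L R) = (nverts L + nverts R).+1.
Proof. by []. Qed.

Lemma is_tree_ext f g o o' T :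
  (forall t, t < nverts T -> f (o + t) = g (o' + t)) ->
  is_tree f o T -> is_tree g o' T.
Proof.
elim: T o o' => [//|L IHL R IHR] o o' e [tL tR h]; split.
- by apply: IHL tL => t tn; apply: e; rewrite nverts_Node; lia.
- apply: IHR tR => t tn; rewrite !addSnnS -!addnA; apply: e.
  by rewrite nverts_Node; lia.
- move=> t /andP[ot tn] tv; rewrite -e ?nverts_Node; last by lia.
  have := e (t - o'); rewrite subnKC // => <-; last by lia.
  by apply: h; try lia; rewrite -?(eqn_add2l o); lia.
Qed.

Lemma uniq_min_split (u : seq nat) : uniq u -> u != [::] ->
  exists u1 m u2, u = u1 ++ m :: u2 /\ all (leq m.+1) (u1 ++ u2).
Proof.
case: u => // x u uu _; set s := x :: u in uu *.
have [m ms mle] := @ex_minnP (mem s) (ex_intro _ x (mem_head x u)).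
case/splitPr: ms uu mle => u1 u2 uu mle; exists u1, m, u2; split=> //.
apply/allP => y yu; rewrite ltn_neqAle mle ?inE ?mem_cat ?inE; last first.
  by move: yu; rewrite mem_cat; case/orP => ->; rewrite ?orbT.
rewrite andbT; apply: contraL uu => /eqP my; move: yu; rewrite -my.
by rewrite -cat1s uniq_catCA cat1s cons_uniq => ->.
Qed.

Lemma inc_tree_spec (u : seq nat) : uniq u ->
  nverts (inc_tree u) = size u /\ is_tree (nth 0 u) 0 (inc_tree u).
Proof.
have [n] := ubnP (size u); elim: n u => // n IH u; rewrite ltnS => un uu.
have [->//|u0] := eqVneq u [::].
have [u1 [m [u2 [uE h]]]] := uniq_min_split uu u0.
move: un uu; rewrite uE size_cat /= cat_uniq /= => un /and4P[uu1 _ _ uu2].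
have [n1 t1] : nverts (inc_tree u1) = size u1 /\ is_tree (nth 0 u1) 0
  (inc_tree u1).
  by apply: IH => //; lia.
have [n2 t2] : nverts (inc_tree u2) = size u2 /\ is_tree (nth 0 u2) 0
  (inc_tree u2).
  by apply: IH => //; lia.
rewrite (inc_treeE h) /= n1 n2; split; first lia.
split.
- by apply: is_tree_ext t1 => t; rewrite n1 !add0n nth_cat => ->.
- apply: is_tree_ext t2 => t _; rewrite !add0n nth_cat ltnNge.
  have -> : size u1 <= (size u1).+1 + t by lia.
  by have -> : (size u1).+1 + t - size u1 = t.+1 by lia.
- move=> t; rewrite !add0n /= => tn tv; rewrite !nth_cat ltnn subnn /=.
  move/allP: h => h; case: (ltnP t) => tu; apply: h; rewrite mem_cat.
    by rewrite mem_nth.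
  have [j tE] : exists j, t = size u1 + j.+1 by exists (t - size u1).-1; lia.
  have ju : j < size u2 by lia.
  by rewrite tE addKn /= mem_nth ?orbT.
Qed.

(** It suffices that the roots coincide. If the minimum of one word lay at [v1], before the minimum
    [v2 = j + 1] of the other, step [j] would be a descent in both, so the first word would have a
    red dot in column [j]. The second would have it too, which needs a value below its minimum. *)
Lemma is_tree_same_data f g a b T T' : inj_on a b f -> inj_on a b g ->
  (forall i, a <= i -> i.+1 < b -> wup f i = wup g i) ->
  (forall i j, a <= i -> i.+1 < b -> a <= j -> j.+1 < b ->
    wdot f i j = wdot g i j) ->
  a + nverts T = b -> a + nverts T' = b ->
  is_tree f a T -> is_tree g a T' -> T = T'.
Proof.
elim: T a b T' => [|L IHL R IHR] a b [|L' R'] fI gI ew ed //;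
  rewrite ?nverts_Node ?addn0; try lia.
move=> nT nT' [tL tR hf] [tL' tR' hg].
rewrite nverts_Node nT in hf; rewrite nverts_Node nT' in hg.
have lt_root f1 g1 v1 v2 : inj_on a b f1 -> a <= v1 < b -> a <= v2 < b ->
    (forall i, a <= i -> i.+1 < b -> wup f1 i = wup g1 i) ->
    (forall i j, a <= i -> i.+1 < b -> a <= j -> j.+1 < b ->
       wdot f1 i j = wdot g1 i j) ->
    (forall t, a <= t < b -> t != v1 -> f1 v1 < f1 t) ->
    (forall t, a <= t < b -> t != v2 -> g1 v2 < g1 t) -> v2 <= v1.
  move=> f1I v1b v2b ew1 ed1 h1 h2; rewrite leqNgt; apply/negP => v12.
  have [j jE] : exists j, v2 = j.+1 by exists v2.-1; lia.
  subst v2; have wj : wup f1 j = D.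
    by rewrite ew1; try lia; apply/wup_D/ltnW/h2; lia.
  have v1j : v1 < j.
    rewrite ltn_neqAle; apply/andP; split; last lia.
    by apply/eqP => e; move/wup_D: wj; rewrite -e leqNgt h1 //; lia.
  have [|||||i ij] := @wred_column f1 a b v1 j f1I; try lia.
  - by apply: h1; lia.
  - exact/wup_D.
  move/wdot_Red; rewrite ed1; try lia; move/wdot_Red/wredP=> [_].
  by rewrite ltnNge ltnW // h2 //; lia.
have eLL' : nverts L = nverts L'.
  apply: (@addnI a); apply/eqP; rewrite eqn_leq; apply/andP; split.
    by apply: (lt_root g f) => // *; try lia; rewrite ?ew ?ed.
  by apply: (lt_root f g) => //; lia.
rewrite -eLL' in tR'; congr Node.
  apply: (IHL a (a + nverts L)) => //; try lia; rewrite -?eLL' //.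
  - by move=> i j ? ?; apply: fI; lia.
  - by move=> i j ? ?; apply: gI; lia.
  - by move=> *; apply: ew; lia.
  - by move=> *; apply: ed; lia.
apply: (IHR (a + nverts L).+1 b) => //; try lia.
- by move=> i j ? ?; apply: fI; lia.
- by move=> i j ? ?; apply: gI; lia.
- by move=> *; apply: ew; lia.
- by move=> *; apply: ed; lia.
Qed.

(** * The shape and the dots of a tree, read off a word *)

Lemma size_right_steps T : size (right_steps T) = nverts T.
Proof. by elim: T => //= L IHL R IHR; rewrite size_cat /= IHL IHR addnS. Qed.

Lemma right_steps_last T i : i.+1 = nverts T -> nth D (right_steps T) i = D.
Proof.
elim: T i => [//|L IHL R IHR] i /= [iE].
rewrite nth_cat size_right_steps iE ltnNge leq_addr addKn /=.
case: R IHR {iE} => //= R1 R2 IHR; exact: IHR.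
Qed.

(** Vertex [i + 1] is in the right subtree of [i] if there is one, and otherwise [i] is in the left
    subtree of [i + 1]; labels increase away from the root. *)
Lemma right_steps_wup f o T i : is_tree f o T -> i.+1 < nverts T ->
  nth D (right_steps T) i = wup f (o + i).
Proof.
elim: T o i => [//|L IHL R IHR] o i [tL tR h]; rewrite nverts_Node in h *.
move=> iT /=; rewrite nth_cat size_right_steps.
case: (ltngtP i.+1 (nverts L)) => [iL|Li|iL].
- by rewrite (IHL o).
- case: (ltngtP (nverts L) i) => [Li'|iL|e]; [|lia|].
    have [m iE] : exists m, i = (nverts L + m).+1 by exists (i - (nverts
      L).+1); lia.
    have -> : i - nverts L = m.+1 by lia.
    rewrite /= (IHR _ _ tR); last by lia.
    by congr wup; lia.
  rewrite e subnn /=; case: R {IHR tR} h iT => [|R1 R2] h iT;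
    first by move: iT => /=; lia.
  by symmetry; apply/wup_U; rewrite -e -addnS; apply: h; rewrite ?nverts_Node;
    lia.
- rewrite right_steps_last //; symmetry; apply/wup_D.
  by rewrite -addnS iL; apply/ltnW/h; lia.
Qed.

(* The subtree occupies the vertices o, ..., e - 1 among 0, ..., N - 1; hence
   the nearest right edge above it has index o - 1, the nearest left edge above
   it has index e - 1, and they hang from the smaller vertices o - 1 and e. *)
Definition anc_spec (f : nat -> nat) N o e (anc : seq edge) :=
  (if [seq g <- anc | g.1 != ToLeft] is g :: _ then
     [/\ 0 < o, g.2 = o.-1 & forall t, o <= t < e -> f o.-1 < f t]
   else o = 0) /\
  (if [seq g <- anc | g.1 != ToRight] is g :: _ then
     [/\ e < N, g.2 = e.-1 & forall t, o <= t < e -> f e < f t]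
   else e = N).

Lemma path_dot_left f N o e anc n : anc_spec f N o e anc ->
  path_dot ((ToLeft, n) :: anc) = if 0 < o then Some (o.-1, n, Red) else None.
Proof.
case=> + _; rewrite /=; case: [seq _ <- _ | _] => [->//|g s].
by case=> -> ->.
Qed.

Lemma path_dot_right f N o e anc n : anc_spec f N o e anc ->
  path_dot ((ToRight, n) :: anc) = if e < N then Some (n, e.-1, Blue) else None.
Proof.
case=> _; rewrite /=; case: [seq _ <- _ | _] => [->|g s]; first by rewrite ltnn.
by case=> -> ->.
Qed.

(** In the left subtree of [v] the interval ends just before [v], whose value is smaller, and the
    nearest left edge is the one just taken; the lower end [o] stays. *)
Lemma anc_spec_left f N o e anc v : anc_spec f N o e anc -> o <= v < e ->
  (forall t, o <= t < e -> t != v -> f v < f t) ->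
  anc_spec f N o v ((ToLeft, v.-1) :: anc).
Proof.
case=> hR hL ove h; split=> /=.
  case: [seq _ <- _ | _] hR => [//|g s] [o0 gE hg]; split=> // t tv.
  by apply: hg; lia.
split=> //; last by move=> t tv; apply: h; lia.
by case: [seq _ <- _ | _] hL => [|g s [] ?]; lia.
Qed.

Lemma anc_spec_right f N o e anc v : anc_spec f N o e anc -> o <= v < e ->
  (forall t, o <= t < e -> t != v -> f v < f t) ->
  anc_spec f N v.+1 e ((ToRight, v) :: anc).
Proof.
case=> hR hL ove h; split=> /=.
  by split=> // t tv; apply: h; lia.
case: [seq _ <- _ | _] hL => [//|g s] [o0 gE hg]; split=> // t tv.
by apply: hg; lia.
Qed.

Lemma anc_spec_le f N o e anc : anc_spec f N o e anc -> e <= N.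
Proof. by case=> _; case: [seq _ <- _ | _] => [->|g s [] /ltnW]. Qed.

(** A red dot in column [v - 1] needs the nearest value to the left of [v] below [f v]. There is
    none from [o] on, since [v] is the minimum, and [o - 1], if it exists, is below the whole
    interval. *)
Lemma anc_spec_wred f N o e anc v i : anc_spec f N o e anc -> o < v < e ->
  (forall t, o <= t < e -> t != v -> f v < f t) ->
  wred f i v.-1 <-> 0 < o /\ i = o.-1.
Proof.
case=> hR _ ove h; have vE : v.-1.+1 = v by lia.
split=> [/wredP[]|[o0 ->]].
  rewrite vE => iv fiv hi.
  have io : i < o.
    by rewrite ltnNge; apply/negP => oi; move: fiv;
      rewrite ltnNge ltnW // h //; lia.
  case: [seq _ <- _ | _] hR => [?|g s [o0 gE hg]]; first lia.
  split=> //; case: (ltnP i o.-1) => io'; last lia.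
  have := hi o.-1; have := hg v; lia.
apply/wredP; rewrite vE; split; first lia.
  case: [seq _ <- _ | _] hR => [?|g s [o0' gE hg]]; first lia.
  by apply: hg; lia.
by move=> t tv; apply: h; lia.
Qed.

(** Symmetrically, the first value after [v] below [f v] is at [e], if [e] is a vertex. *)
Lemma anc_spec_wblue f N o e anc v j : anc_spec f N o e anc -> o <= v ->
  v.+1 < e ->
  (forall t, o <= t < e -> t != v -> f v < f t) -> j.+1 < N ->
  wblue f v j <-> e < N /\ j = e.-1.
Proof.
case=> _ hL ov ve h jN.
split=> [/wblueP[vj fvj hj]|[eN ->]].
  have ej : e <= j.+1.
    by rewrite leqNgt; apply/negP => je; move: fvj;
      rewrite ltnNge ltnW // h //; lia.
  case: [seq _ <- _ | _] hL => [?|g s [eN gE hg]]; first lia.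
  split=> //; case: (ltnP e j.+1) => je; last lia.
  have := hj e; have := hg v; lia.
have eE : e.-1.+1 = e by lia.
apply/wblueP; rewrite eE; split; first lia.
  case: [seq _ <- _ | _] hL => [?|g s [eN' gE hg]]; first lia.
  by apply: hg; lia.
by move=> t tv; apply: h; lia.
Qed.

Lemma mem_child_paths (T : btree) (el : seq edge) o x :
  x \in pmap path_dot (if T is Leaf then [::] else el :: edge_paths T o el) <->
  (0 < nverts T /\ path_dot el = Some x) \/
  x \in pmap path_dot (edge_paths T o el).
Proof.
case: T => [|L R].
  by split=> [//|[[]|]].
rewrite [pmap _ _]/= -/(edge_paths (Node L R) o el).
move: (edge_paths (Node L R) o el) => s.
case: (path_dot el) => [y|] /=; rewrite ?in_cons; split.
- by case/orP => [/eqP->|->]; [left|right].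
- by case=> [[_ [->]]|->]; rewrite ?eqxx ?orbT.
- by move=> ->; right.
- by case=> [[]|].
Qed.

(** The colour tells the direction of the edge, whose own index is [j] for red and [i] for blue; the
    edges inside a subtree are those whose index and its successor are both vertices of it. The
    other coordinate may lie outside the subtree, hence the bound [j.+1 < N]. *)
Lemma mem_edge_paths f N T o anc i j c : is_tree f o T ->
  anc_spec f N o (o + nverts T) anc ->
  (i, j, c) \in pmap path_dot (edge_paths T o anc) <->
  if c is Red then [/\ o <= j, j.+1 < o + nverts T & wred f i j]
  else [/\ o <= i, i.+1 < o + nverts T, j.+1 < N & wblue f i j].
Proof.
elim: T o anc => [|L IHL R IHR] o anc.
  by move=> _ _; split=> //; case: c => -[] /=; lia.
case=> tL tR; set T := Node L R; set v := o + nverts L => h sp.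
have eE : o + nverts T = v.+1 + nverts R by rewrite /T nverts_Node; lia.
rewrite eE in h sp *; set e := v.+1 + nverts R in h sp *.
have ove : o <= v < e by lia.
have spL := anc_spec_left sp ove h; have spR := anc_spec_right sp ove h.
have eN := anc_spec_le sp.
rewrite [edge_paths _ _ _]/= -/v pmap_cat mem_cat.
split.
  case/orP => /mem_child_paths[[n0]|].
  - rewrite (path_dot_left _ sp); case: ifP => // o0 [ei ej ec];
      rewrite -ei -ej -ec.
    split; try lia.
    by apply/(anc_spec_wred (v := v) _ sp) => //; lia.
  - by move/(IHL _ _ tL spL); case: (c) => -[] *; split=> //; lia.
  - rewrite (path_dot_right _ sp); case: ifP => // o0 [ei ej ec];
      rewrite -ei -ej -ec.
    split; try lia.
    by apply/(anc_spec_wblue (v := v) sp) => //; lia.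
  - by move/(IHR _ _ tR spR); case: (c) => -[] *; split=> //; lia.
move=> H; apply/orP.
(* [k] is the index of the edge that should carry the dot: it is the left edge at [v] if
   [k + 1 = v], the right edge at [v] if [k = v], and otherwise lies in one of the two subtrees. The
   wrong colour at [v] contradicts the minimality of [f v]. *)
pose k := if c is Red then j else i.
have ke : o <= k /\ k.+1 < e by rewrite /k; case: (c) H => -[].
case: (ltngtP k.+1 v) => [kv|vk|kv].
- left; apply/mem_child_paths; right; apply/(IHL _ _ tL spL).
  by move: H kv; rewrite /k; case: (c) => -[] *; split=> //; lia.
- case: (ltngtP k v) => [|vk'|kv]; first lia.
    right; apply/mem_child_paths; right; apply/(IHR _ _ tR spR).
    by move: H vk'; rewrite /k; case: (c) => -[] *; split=> //; lia.
  right; apply/mem_child_paths; left; split; first lia.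
  rewrite (path_dot_right _ sp).
  move: H kv; rewrite /k; move: ke vk; rewrite /k; case: (c) => ke vk [].
    move=> oi ie jN bl iv; subst i.
    have ov : o <= v by lia.
    by have [-> ->] := iffLR (anc_spec_wblue sp ov ie h jN) bl.
  move=> oj je /wredP[ij _ hj] jv; subst j; have := hj v; have := h v.+1; lia.
- left; apply/mem_child_paths; left; split; first lia.
  rewrite (path_dot_left _ sp).
  move: H kv; rewrite /k; move: ke; rewrite /k; case: (c) => ke [].
    by move=> oi ie jN /wblueP[ij _ hi] iv; have := hi v; have := h i; lia.
  move=> oj je rd jv; have jE : j = v.-1 by lia.
  rewrite jE in rd *.
  have ove' : o < v < e by lia.
  by have [-> ->] := iffLR (anc_spec_wred _ sp ove' h) rd.
Qed.

Lemma mem_tree_dots f T i j c : is_tree f 0 T -> i.+1 < nverts T ->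
  j.+1 < nverts T -> (i, j, c) \in tree_dots T <-> wdot f i j = Some c.
Proof.
move=> tT iT jT; rewrite /tree_dots (mem_edge_paths (f := f) (N := nverts T))
  //.
case: c; [rewrite wdot_Blue | rewrite wdot_Red].
  by split=> [[]|].
by split=> [[]|].
Qed.

(** * Words with the same tableau, and words of a given tree *)

Lemma inj_on_nth (u : seq nat) n : uniq u -> size u = n -> inj_on 0 n (nth 0 u).
Proof.
by move=> uu <- i j /= iu ju /eqP; rewrite nth_uniq // => /eqP.
Qed.

(** Dots are compared on cells only, as in the conditions on a product tableau; elsewhere there are
    none. *)
Definition same_data n (f g : nat -> nat) :=
  (forall i, i.+1 < n -> wup f i = wup g i) /\
  (forall i j, i < j -> j.+1 < n -> wup f i = U -> wup f j = D ->
     wdot f i j = wdot g i j).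

Lemma inc_tree_same_data (u u' : seq nat) n : uniq u -> uniq u' ->
  size u = n -> size u' = n -> same_data n (nth 0 u) (nth 0 u') ->
  inc_tree u = inc_tree u'.
Proof.
move=> uu uu' su su' [ew ed].
have [nT tT] := inc_tree_spec uu; have [nT' tT'] := inc_tree_spec uu'.
have fI := inj_on_nth uu su; have gI := inj_on_nth uu' su'.
apply: (is_tree_same_data fI gI _ _ _ _ tT tT'); rewrite ?nT ?nT' //.
  by move=> i _; exact: ew.
have cf := cat_on_word fI; have cg := cat_on_word gI.
move=> i j _ iN _ jN.
case e : (wdot (nth 0 u) i j) => [c|].
  have [|||||ij wi wj] := cat_cell cf (i := i) (j := j); rewrite ?e //.
  by rewrite -e ed.
case e' : (wdot (nth 0 u') i j) => [c|] //.
have [|||||ij wi wj] := cat_cell cg (i := i) (j := j); rewrite ?e' //.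
by rewrite -e -e' ed // ew.
Qed.

Lemma same_data_ext n f g :
  (forall s t, s < n -> t < n -> (f s < f t) = (g s < g t)) -> same_data n f g.
Proof.
move=> e; split=> [i iN|i j ij jN _ _].
  by apply: (@wup_ext _ _ 0 n) => // s t /= sn tn; apply: e.
by apply: (@wdot_ext _ _ 0 n) => // s t /= sn tn; apply: e.
Qed.

Lemma same_data_extl n f f' g : (forall t, t < n -> f t = f' t) ->
  same_data n f g -> same_data n f' g.
Proof.
move=> e [sw sd].
have e' s t : 0 <= s < n -> 0 <= t < n -> (f' s < f' t) = (f s < f t).
  by move=> /= sn tn; rewrite !e.
split=> [i iN|i j ij jN]; first by rewrite (wup_ext e') // sw.
by rewrite !(wup_ext e') ?(wdot_ext e') //; [exact: sd | lia].
Qed.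

(** Obtained through the tableau, which only sees comparisons of letters. *)
Lemma inc_tree_order_iso (u u' : seq nat) : uniq u -> uniq u' ->
  size u = size u' ->
  (forall s t, s < size u -> t < size u ->
     (nth 0 u s < nth 0 u t) = (nth 0 u' s < nth 0 u' t)) ->
  inc_tree u = inc_tree u'.
Proof.
move=> uu uu' su e; apply: (inc_tree_same_data uu uu' (n := size u)) => //.
exact: same_data_ext.
Qed.

Lemma inc_tree_map_mono (g : nat -> nat) u : uniq u ->
  (forall x y, x \in u -> y \in u -> (g x < g y) = (x < y)) ->
  inc_tree [seq g x | x <- u] = inc_tree u.
Proof.
move=> uu mg; apply: inc_tree_order_iso; rewrite ?size_map //.
  rewrite map_inj_in_uniq // => x y xu yu e.
  by have := mg x y xu yu; have := mg y x yu xu; rewrite e; lia.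
by move=> s t su tu; rewrite !(nth_map 0) // mg // mem_nth.
Qed.

(** Label the root 0, the left subtree with the next letters and the right subtree with the
    remaining ones. *)
Lemma tree_word T :
  exists2 u : seq nat, perm_eq u (iota 0 (nverts T)) & inc_tree u = T.
Proof.
elim: T => [|L [uL pL tL] R [uR pR tR]]; first by exists [::].
have uuL : uniq uL by rewrite (perm_uniq pL) iota_uniq.
have uuR : uniq uR by rewrite (perm_uniq pR) iota_uniq.
exists (map (addn 1) uL ++ 0 :: map (addn (nverts L).+1) uR).
  rewrite -cat1s perm_catCA cat1s /= perm_cons.
  have iE m n : iota m n = map (addn m) (iota 0 n) by rewrite -iotaDl addn0.
  by rewrite iotaD add1n !(iE _.+1); apply: perm_cat; exact: perm_map.
rewrite inc_treeE.
  have m c u : uniq u -> inc_tree (map (addn c) u) = inc_tree u.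
    by move/inc_tree_map_mono; apply=> x y _ _; rewrite ltn_add2l.
  by rewrite !m ?tL ?tR.
by apply/allP => x; rewrite mem_cat => /orP[] /mapP[y _ ->].
Qed.

Lemma tree_wordP T : exists u, [/\ uniq u, size u = nverts T & inc_tree u = T].
Proof.
have [u pu tu] := tree_word T; exists u; split=> //.
  by rewrite (perm_uniq pu) iota_uniq.
by rewrite (perm_size pu) size_iota.
Qed.

(** * The bijection with trees *)

Lemma fillingP m (C C' : filling m) :
  (forall i, i < m -> nth D (tshape C) i = nth D (tshape C') i) ->
  (forall i j, i < m -> j < m -> dot C i j = dot C' i j) -> C = C'.
Proof.
case: C C' => w d [w' d'] /= ew ed; congr pair.
  by apply: eq_from_tnth => i; rewrite !(tnth_nth D) ew.
by apply/ffunP => -[i j]; have := ed i j (ltn_ord i) (ltn_ord j); rewrite !dotE.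
Qed.

Lemma cellE m (w : m.-tuple step) (i j : 'I_m) :
  cell w i j <-> [/\ i < j, nth D w i = U & nth D w j = D].
Proof.
rewrite /cell !(tnth_nth D); split=> [/and3P[? /eqP ? /eqP ?]|[? -> ->]] //.
by rewrite eqxx andbT.
Qed.

(** Size [m] means [m + 1] vertices. The witness of fullness in [catalan] is bounded on one side
    only; the other bound holds because every dot sits in a cell. *)
Lemma catalanP m (C : filling m) :
  catalan C <-> cat_on (nth D (tshape C)) (dot C) 0 m.+1.
Proof.
split.
  case/and4P => /'forall_forallP h1 /'forall_forallP h2 /'forall_forallP h3
    /'forall_forallP h4; split.
  - move=> i j _ /ltnSE im _ /ltnSE jm d.
    apply/(@cellE m _ (Ordinal im) (Ordinal jm)).
    by apply: (implyP (h1 (Ordinal im) (Ordinal jm))); apply/eqP.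
  - move=> i i' j _ ii' /ltnSE im _ /ltnSE jm r; apply/eqP.
    have i'm : i' < m by lia.
    have /forallP/(_ (Ordinal i'm))/implyP := h2 (Ordinal im) (Ordinal jm).
    by apply; rewrite /= r eqxx.
  - move=> i j j' _ /ltnSE im _ jj' /ltnSE j'm b; apply/eqP.
    have jm : j < m by lia.
    have /forallP/(_ (Ordinal j'm))/implyP := h3 (Ordinal im) (Ordinal jm).
    by apply; rewrite /= b eqxx.
  - move=> i j _ ij /ltnSE jm wi wj dN; have im : i < m by lia.
    have ce : cell (tshape C) (Ordinal im) (Ordinal jm) by apply/cellE.
    have := h4 (Ordinal im) (Ordinal jm); rewrite ce /= dN eqxx /=.
    case/orP => /existsP[[t tm] /= /andP[lt /eqP e]]; [left|right];
      exists t => //;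
      rewrite lt /=.
      have : dot C t j <> None by rewrite e.
      move/eqP=> h; have /cellE[] := implyP (h1 (Ordinal tm) (Ordinal jm)) h.
      by [].
    have : dot C i t <> None by rewrite e.
    move/eqP=> h; have /cellE[] := implyP (h1 (Ordinal im) (Ordinal tm)) h.
    by rewrite andbT.
case=> h1 h2 h3 h4; apply/and4P; split; apply/'forall_forallP => i j.
- apply/implyP => /eqP d; apply/cellE; apply: h1 => //; exact: ltn_ord.
- apply/forallP => i'; apply/implyP => /andP[/eqP r ii']; apply/eqP.
  by apply: (h2 i) => //; exact: ltn_ord.
- apply/forallP => j'; apply/implyP => /andP[/eqP r jj']; apply/eqP.
  by apply: (h3 i j) => //; exact: ltn_ord.
- apply/implyP => /andP[/cellE[ij wi wj] /eqP dN]; apply/orP.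
  case: (h4 i j _ ij _ wi wj dN) => //; first exact: ltn_ord.
    move=> [t /andP[it tj] e]; left; have tm : t < m by have := ltn_ord j; lia.
    by apply/existsP; exists (Ordinal tm); rewrite /= it e eqxx.
  move=> [t /andP[it tj] e]; right; have tm : t < m by have := ltn_ord j; lia.
  by apply/existsP; exists (Ordinal tm); rewrite /= tj e eqxx.
Qed.

Lemma inc_tree_tableau (u : seq nat) m : uniq u -> size u = m.+1 ->
  (forall i, i < m ->
     nth D (tshape (tableau_of_tree m (inc_tree u))) i = wup (nth 0 u) i) /\
  (forall i j, i < m -> j < m ->
     dot (tableau_of_tree m (inc_tree u)) i j = wdot (nth 0 u) i j).
Proof.
move=> uu su; have [nT tT] := inc_tree_spec uu; rewrite su in nT; split.
  move=> i im; rewrite -[i in LHS]/(val (Ordinal im)) -tnth_nth tnth_mktuple.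
  by rewrite (right_steps_wup tT) ?nT.
move=> i j im jm.
rewrite -[i in LHS]/(val (Ordinal im)) -[j in LHS]/(val (Ordinal jm)) dotE
  ffunE /=.
have H c : ((i, j, c) \in tree_dots (inc_tree u)) = (wdot (nth 0 u) i j ==
  Some c).
  apply/idP/eqP => h; by apply/(mem_tree_dots c tT) => //; rewrite nT.
case: pickP => [c|N]; first by rewrite H => /eqP.
by case e : (wdot _ _ _) => [c|] //; have := N c; rewrite H e eqxx.
Qed.

Lemma tableau_of_tree_catalan m T : nverts T = m.+1 ->
  catalan (tableau_of_tree m T).
Proof.
have [u [uu <- <-]] := tree_wordP T => su.
have [ew ed] := inc_tree_tableau uu su; apply/catalanP.
apply: cat_on_ext (cat_on_word (inj_on_nth uu su)).
  by move=> i _ im; rewrite ew.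
by move=> i j _ im _ jm; rewrite ed.
Qed.

Lemma tableau_of_tree_inj m T T' : nverts T = m.+1 -> nverts T' = m.+1 ->
  tableau_of_tree m T = tableau_of_tree m T' -> T = T'.
Proof.
have [u [uu <- <-]] := tree_wordP T; have [u' [uu' <- <-]] := tree_wordP T'.
move=> su su' e; have [ew ed] := inc_tree_tableau uu su.
have [ew' ed'] := inc_tree_tableau uu' su'; rewrite {}e in ew ed.
apply: (inc_tree_same_data uu uu' su su'); split=> [i iN|i j ij jN _ _].
  by rewrite -ew // ew'.
by rewrite -ed ?ed' //; lia.
Qed.

Lemma tableau_of_tree_surj m (C : filling m) : catalan C ->
  exists T, nverts T = m.+1 /\ tableau_of_tree m T = C.
Proof.
move/catalanP => cC; have [f [fI fw fd]] := cat_on_realized (leqnn _) cC.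
pose u := mkseq f m.+1.
have su : size u = m.+1 by rewrite size_mkseq.
have uu : uniq u.
  rewrite map_inj_in_uniq ?iota_uniq // => x y; rewrite !mem_iota; exact: fI.
have fu s t : 0 <= s < m.+1 -> 0 <= t < m.+1 ->
  (nth 0 u s < nth 0 u t) = (f s < f t).
  by move=> /= sm tm; rewrite !nth_mkseq.
exists (inc_tree u); have [nT _] := inc_tree_spec uu; split;
  first by rewrite nT.
have [ew ed] := inc_tree_tableau uu su.
apply: fillingP => [i im|i j im jm].
  by rewrite ew // -fw //; apply: (wup_ext fu).
by rewrite ed // -fd //; apply: (wdot_ext fu).
Qed.

Lemma tree_of_tableauP m (C : filling m) : catalan C ->
  nverts (tree_of_tableau C) = m.+1 /\
  tableau_of_tree m (tree_of_tableau C) = C.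
Proof. by move=> /tableau_of_tree_surj; apply: epsilon_spec. Qed.

(** * Product tableaux in terms of words *)

Lemma wup_shift f k i : wup (fun t => f (k + t)) i = wup f (k + i).
Proof. by rewrite /wup addnS. Qed.

Lemma wdot_shift f k i j :
  wdot (fun t => f (k + t)) i j = wdot f (k + i) (k + j).
Proof.
have -> : wdot f (k + i) (k + j) =
    if wred f (k + i) (k + j) then Some Red else
    if wblue f (k + i) (k + j) then Some Blue else None by [].
have -> : wred f (k + i) (k + j) = wred (fun t => f (k + t)) i j.
  apply/wredP/wredP; rewrite ltn_add2l addnS => -[ij lt h]; split=> // t tij.
    by apply: h; lia.
  by have := h (t - k); rewrite subnKC; lia.
have -> : wblue f (k + i) (k + j) = wblue (fun t => f (k + t)) i j.
  apply/wblueP/wblueP; rewrite ltn_add2l addnS => -[ij lt h]; split=> // t tij.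
    by apply: h; lia.
  by have := h (t - k); rewrite subnKC; lia.
by [].
Qed.

(** The tableau of a tree is Catalan and its letter at position [k] is free, so what remains is that
    the prefix of [r] agrees with [u1] and the suffix with [u2]; both are read locally on [r]. *)
Lemma mem_product_tableaux (r u1 u2 : seq nat) k l :
  uniq r -> uniq u1 -> uniq u2 ->
  size r = k.+1 + l.+1 -> size u1 = k.+1 -> size u2 = l.+1 ->
  tableau_of_tree (k.+1 + l.+1).-1 (inc_tree r) \in
    @product_tableaux k.+1 l.+1 (tableau_of_tree k (inc_tree u1))
      (tableau_of_tree l (inc_tree u2)) <->
  same_data k.+1 (nth 0 r) (nth 0 u1) /\
  same_data l.+1 (fun t => nth 0 r (k.+1 + t)) (nth 0 u2).
Proof.
move=> ur uu1 uu2 sr s1 s2.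
have [nT _] := inc_tree_spec ur.
have [ew ed] := inc_tree_tableau ur (sr : size r = (k.+1 + l.+1).-1.+1).
have [ew1 ed1] := inc_tree_tableau uu1 s1.
have [ew2 ed2] := inc_tree_tableau uu2 s2.
have cC : catalan (tableau_of_tree (k.+1 + l.+1).-1 (inc_tree r)).
  by apply: tableau_of_tree_catalan; rewrite nT.
move: (tableau_of_tree (k.+1 + l.+1).-1 _) (tableau_of_tree k _)
  (tableau_of_tree l _) ew ed ew1 ed1 ew2 ed2 cC =>
    C C1 C2 ew ed ew1 ed1 ew2 ed2 cC.
rewrite inE cC /=; split.
  case/and3P => /existsP[s /eqP sh] /'forall_forallP h1 /'forall_forallP h2.
  have sw1 i : i < k -> wup (nth 0 r) i = wup (nth 0 u1) i.
    move=> ik; rewrite -ew /=; last lia.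
    by rewrite sh nth_cat size_tuple ik ew1.
  have sw2 i : i < l -> wup (nth 0 r) (k.+1 + i) = wup (nth 0 u2) i.
    move=> il; rewrite -ew /=; last lia.
    rewrite sh nth_cat size_tuple ltnNge; have -> : k <= k.+1 + i by lia.
    (* Position [k] holds the free letter, so the second shape starts one further on. *)
    have -> : k.+1 + i - k = i.+1 by lia.
    by rewrite /= ew2.
  split; split=> //.
  - move=> i j ij jk wi wj.
    have im : i < (k.+1 + l.+1).-1 by lia.
    have jm : j < (k.+1 + l.+1).-1 by lia.
    have /implyP := h1 (Ordinal im) (Ordinal jm); rewrite /= ed // ed1 //;
      last by lia.
    move=> h; apply/eqP/h; apply/andP; split; last by lia.
    by apply/cellE; rewrite /= !ew.
  - by move=> i il; rewrite wup_shift sw2.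
  - move=> i j ij jl; rewrite !wup_shift wdot_shift => wi wj.
    have im : k.+1 + i < (k.+1 + l.+1).-1 by lia.
    have jm : k.+1 + j < (k.+1 + l.+1).-1 by lia.
    have /implyP := h2 (Ordinal im) (Ordinal jm);
      rewrite /= ed // !addKn ed2 //; last by lia.
    move=> h; apply/eqP/h; apply/andP; split; last by lia.
    by apply/cellE; rewrite /= !ew // ltn_add2l.
case=> -[sw1 sd1] [sw2 sd2]; apply/and3P; split.
- apply/existsP; exists (nth D (tshape C) k); apply/eqP.
  apply: (@eq_from_nth _ D); first by rewrite size_cat /= !size_tuple.
  rewrite size_tuple => i im; rewrite nth_cat size_tuple.
  case: (ltngtP i k) => [ik|ki|->]; last by rewrite subnn.
    by rewrite ew // sw1 // ew1.
  have [t iE] : exists t, i = k.+1 + t by exists (i - k.+1); lia.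
  have -> : i - k = t.+1 by lia.
  by rewrite /= ew // ew2 -?sw2 ?wup_shift ?iE //; lia.
- apply/'forall_forallP => i j; apply/implyP => /andP[/cellE[ij wi wj] jk].
  by rewrite ed // ed1 ?sd1 //; try lia; rewrite -ew.
- apply/'forall_forallP => i j; apply/implyP => /andP[/cellE[ij wi wj] ki].
  have := ltn_ord i; have := ltn_ord j => jm im.
  have [s iE] : exists s, i = k.+1 + s :> nat by exists (i - k.+1); lia.
  have [t jE] : exists t, j = k.+1 + t :> nat by exists (j - k.+1); lia.
  rewrite ed // ed2; try lia; rewrite -sd2; try lia.
  + by rewrite wdot_shift iE jE !addKn.
  + by rewrite wup_shift iE addKn -iE -ew.
  + by rewrite wup_shift jE addKn -jE -ew.
Qed.

(** Equal data and equal trees are interchangeable: one direction takes the two factors of [r] as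
    words of [T1] and [T2], the other takes any such words and uses injectivity. *)
Lemma tableau_mem_product (r : seq nat) T1 T2 k l :
  uniq r -> size r = k.+1 + l.+1 -> nverts T1 = k.+1 -> nverts T2 = l.+1 ->
  (tableau_of_tree (k.+1 + l.+1).-1 (inc_tree r) \in
    @product_tableaux k.+1 l.+1 (tableau_of_tree k T1) (tableau_of_tree l T2)) =
  (inc_tree (take k.+1 r) == T1) && (inc_tree (drop k.+1 r) == T2).
Proof.
move=> ur sr n1 n2.
have st : size (take k.+1 r) = k.+1 by rewrite size_takel // sr leq_addr.
have sd : size (drop k.+1 r) = l.+1 by rewrite size_drop sr addKn.
have ut : uniq (take k.+1 r) by exact: take_uniq.
have ud : uniq (drop k.+1 r) by exact: drop_uniq.
have lt_t s t : s < k.+1 -> t < k.+1 ->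
    (nth 0 r s < nth 0 r t) = (nth 0 (take k.+1 r) s < nth 0 (take k.+1 r) t).
  by move=> sk tk; rewrite !nth_take.
have nd t : nth 0 (drop k.+1 r) t = nth 0 r (k.+1 + t) by rewrite nth_drop.
apply/idP/andP => [|[/eqP<- /eqP<-]]; last first.
  apply/mem_product_tableaux => //; split; apply: same_data_ext => s t sk tk.
    exact: lt_t.
  by rewrite !nd.
have [u1 [uu1 s1 <-]] := tree_wordP T1; have [u2 [uu2 s2 <-]] := tree_wordP T2.
rewrite n1 in s1; rewrite n2 in s2.
case/(mem_product_tableaux ur uu1 uu2 sr s1 s2) => d1 d2.
split; apply/eqP.
  apply: (inc_tree_same_data ut uu1 st s1); apply: same_data_extl d1 => t tk.
  by rewrite nth_take.
by apply: (inc_tree_same_data ud uu2 sd s2); apply: same_data_extl d2 => t _.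
Qed.

(** * The two products *)

Lemma uniq_perm_word n (s : 'S_n) : uniq (perm_word s).
Proof. by rewrite (perm_uniq (perm_word_iota s)) iota_uniq. Qed.

Lemma perm_word_surj n (u : seq nat) : perm_eq u (iota 0 n) ->
  exists s : 'S_n, perm_word s = u.
Proof.
move=> pu; have su : size u = n by rewrite (perm_size pu) size_iota.
have uu : uniq u by rewrite (perm_uniq pu) iota_uniq.
have lu i : i < n -> nth 0 u i < n.
  move=> lti; have : nth 0 u i \in u by rewrite mem_nth ?su.
  by rewrite (perm_mem pu) mem_iota.
pose f (i : 'I_n) : 'I_n := Ordinal (lu i (ltn_ord i)).
have fI : injective f.
  by move=> i j [] /eqP; rewrite nth_uniq ?su // => /eqP/val_inj.
exists (perm fI); apply: (@eq_from_nth _ 0); rewrite ?size_perm_word ?su //.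
move=> i lti; rewrite (nth_map (Ordinal lti)) ?size_enum_ord // permE /=.
by rewrite nth_enum_ord.
Qed.

Lemma nverts_Psi n (s : 'S_n) : nverts (Psi s) = n.
Proof. by have [-> _] := inc_tree_spec (uniq_perm_word s);
  rewrite size_perm_word. Qed.

Lemma Psi_surj T : exists s : 'S_(nverts T), Psi s = T.
Proof.
have [u /perm_word_surj[s su] tu] := tree_word T.
by exists s; rewrite /Psi su.
Qed.

Lemma size_letters N (A : {set 'I_N}) : size (letters A) = #|A|.
Proof. by rewrite size_map -cardE. Qed.

Lemma letters_uniq N (A : {set 'I_N}) : uniq (letters A).
Proof. by rewrite map_inj_uniq ?enum_uniq //; exact: val_inj. Qed.

Lemma mem_letters N (A : {set 'I_N}) (x : 'I_N) :
  (val x \in letters A) = (x \in A).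
Proof. by rewrite mem_map ?mem_enum //; exact: val_inj. Qed.

Lemma size_relabel m N (s : 'S_m) (A : {set 'I_N}) : size (relabel s A) = m.
Proof. by rewrite size_map size_perm_word. Qed.

Lemma relabel_inj m N (s s' : 'S_m) (A A' : {set 'I_N}) :
  #|A| = m -> #|A'| = m -> relabel s A = relabel s' A' -> s = s' /\ A = A'.
Proof.
move=> cA cA' e; have [pA sA] := relabelP s cA;
  have [pA' sA'] := relabelP s' cA'.
split; first by apply: perm_word_inj; rewrite -sA -sA' e.
by apply/setP => x; rewrite -!mem_letters -(perm_mem pA) e (perm_mem pA').
Qed.

(** The permutation is the standardization of [v]: each letter is replaced by its rank in [A]. *)
Lemma relabel_surj m N (A : {set 'I_N}) (v : seq nat) :
  #|A| = m -> perm_eq v (letters A) -> exists s : 'S_m, relabel s A = v.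
Proof.
move=> cA pv.
have [s sE] : exists s : 'S_m, perm_word s = [seq index x (letters A) | x <- v].
  apply: perm_word_surj; apply: perm_trans (perm_map _ pv) _.
  have -> : [seq index x (letters A) | x <- letters A] = iota 0 m.
    apply: (@eq_from_nth _ 0);
      first by rewrite size_map size_letters cA size_iota.
    move=> i; rewrite size_map => iA;
      rewrite (nth_map 0) // index_uniq ?letters_uniq //.
    by rewrite nth_iota // -cA -size_letters.
  exact: perm_refl.
exists s; rewrite /relabel sE -map_comp -[RHS]map_id;
  apply/eq_in_map => x xv /=.
by rewrite nth_index // -(perm_mem pv).
Qed.

Lemma inc_tree_relabel m N (s : 'S_m) (A : {set 'I_N}) :
  #|A| = m -> inc_tree (relabel s A) = Psi s.
Proof.
move=> cA; apply: inc_tree_map_mono (uniq_perm_word s) _ => x y.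
have h z : z \in perm_word s -> z < size (letters A).
  by rewrite (perm_mem (perm_word_iota s)) mem_iota size_letters cA.
move=> /h xA /h yA.
have homo a b : b < size (letters A) -> a < b ->
  nth 0 (letters A) a < nth 0 (letters A) b.
  move=> bA ab; apply: (sorted_ltn_nth ltn_trans 0 (letters_sorted A)) => //.
  by rewrite inE (ltn_trans ab).
case: (ltngtP x y) => [xy|yx|->]; rewrite ?ltnn //; first exact: homo.
by apply/negbTE; rewrite -leqNgt ltnW // homo.
Qed.

Local Open Scope ring_scope.

(** Linear extension of [G]. [Psi_star] has this form, and so does [mr_mul] in each argument, so
    sums of basis elements pass through both. *)
Definition malg_lin (F : fieldType) (K : choiceType) (V : lmodType F) (G :
  K -> V)
    (x : {malg F[K]}) : V :=
  \sum_(k <- msupp x) x@_k *: G k.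

(** Allows a common index set for [x], [y] and [x + y], whose supports differ. *)
Lemma malg_linEw (F : fieldType) (K : choiceType) (V : lmodType F) (G : K ->
  V) x (d : {fset K}) :
  (msupp x `<=` d)%fset -> malg_lin G x = \sum_(k <- d) x@_k *: G k.
Proof.
move=> sd; apply: big_fset_incl => // k _ /mcoeff_outdom ->.
by rewrite scale0r.
Qed.

Lemma malg_linD (F : fieldType) (K : choiceType) (V : lmodType F) (G : K ->
  V) x y :
  malg_lin G (x + y) = malg_lin G x + malg_lin G y.
Proof.
rewrite (malg_linEw G (msuppD_le x y)) (malg_linEw G (fsubsetUl _ (msupp y))).
rewrite (malg_linEw G (fsubsetUr (msupp x) _)) -big_split /=.
by apply: eq_bigr => k _; rewrite mcoeffD scalerDl.
Qed.

Lemma malg_linU (F : fieldType) (K : choiceType) (V : lmodType F) (G : K ->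
  V) k :
  malg_lin G << k >> = G k.
Proof. by rewrite /malg_lin msuppU oner_eq0 big_seq_fset1 mcoeffUU scale1r. Qed.

Lemma malg_lin_sum (F : fieldType) (K : choiceType) (V : lmodType F) (G : K ->
  V) (I : finType)
    (P : pred I) (g : I -> K) :
  malg_lin G (\sum_(i | P i) << g i >>) = \sum_(i | P i) G (g i).
Proof.
rewrite (big_morph (malg_lin G) (malg_linD G) (_ : _ = 0)); last first.
  by rewrite /malg_lin msupp0 big_seq_fset0.
by apply: eq_bigr => i _; rewrite malg_linU.
Qed.

Lemma Psi_star_treeE (F : fieldType) T n : nverts T = n ->
  Psi_star_tree F T = \sum_(s : 'S_n | Psi s == T) << (existT _ n s : perms) >>.
Proof. by move=> <-. Qed.

Lemma mcoeff_Psi_star_tree (F : fieldType) T n (s : 'S_n) :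
  (Psi_star_tree F T)@_(existT _ n s : perms) = (Psi s == T)%:R.
Proof.
have [nT|nT] := eqVneq (nverts T) n.
  rewrite (Psi_star_treeE F nT) raddf_sum /= big_mkcond (bigD1 s) //= mcoeffUU.
  rewrite big1 ?addr0 => [|t ts]; first by case: (_ == T).
  case: ifP => // _; rewrite mcoeffU.
  have := @eq_Tagged _ _ (existT (fun n => 'S_n) n t) s; rewrite /Tagged => ->.
  by rewrite /= (negbTE ts).
rewrite /Psi_star_tree raddf_sum /= big1 => [|t _].
  by case: eqP => // e; move: nT; rewrite -e nverts_Psi eqxx.
rewrite mcoeffU; case: eqP => // /(congr1 tag) /= e.
by rewrite e eqxx in nT.
Qed.

(** The sets of permutations with a given tree are disjoint, so [s] occurs only in the term of its
    own tree. *)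
Lemma mcoeff_Psi_star (F : fieldType) (x : {malg F[btree]}) n (s : 'S_n) :
  (Psi_star x)@_(existT _ n s : perms) = x@_(Psi s).
Proof.
rewrite /Psi_star raddf_sum /=.
under eq_bigr => T _ do rewrite mcoeffZ mcoeff_Psi_star_tree.
have [h|h] := boolP (Psi s \in msupp x).
  rewrite (big_fsetD1 (Psi s)) //= eqxx mulr1 big1_fset ?addr0 // => T.
  by rewrite in_fsetD1 eq_sym => /andP[/negbTE -> _]; rewrite mulr0.
rewrite big1_fset ?(mcoeff_outdom h) // => T Tx _.
by case: eqP => [e|_]; rewrite ?mulr0 //; rewrite -e (negbTE h) in Tx.
Qed.

Lemma Psi_star_inj (F : fieldType) : injective (@Psi_star F).
Proof.
move=> x y e; apply/malgP => T; have [s <-] := Psi_surj T.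
by rewrite -!mcoeff_Psi_star e.
Qed.

Lemma mr_mulE (F : fieldType) (x y : {malg F[perms]}) :
  mr_mul x y = malg_lin (fun s =>
    malg_lin (fun t => mr_mul_perm F (projT2 s) (projT2 t)) y) x.
Proof.
apply: eq_bigr => s _; rewrite scaler_sumr.
by apply: eq_bigr => t _; rewrite scalerA.
Qed.

Lemma Psi_starU (F : fieldType) T : Psi_star << T >> = Psi_star_tree F T.
Proof. exact: malg_linU. Qed.

(** Each [r] arises from exactly one triple [(s, t, A)]: [A] is the letter set of the prefix, and
    [s], [t] are the standardizations of prefix and suffix. Standardizing preserves the increasing
    tree. *)
Lemma mr_mul_Psi_star (F : fieldType) T1 T2 p q : nverts T1 = p ->
  nverts T2 = q ->
  mr_mul (Psi_star_tree F T1) (Psi_star_tree F T2) =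
  \sum_(r : 'S_(p + q) | (inc_tree (take p (perm_word r)) == T1) &&
                         (inc_tree (drop p (perm_word r)) == T2))
    << (existT _ (p + q)%N r : perms) >>.
Proof.
move=> n1 n2; rewrite (Psi_star_treeE F n1) (Psi_star_treeE F n2) mr_mulE
  malg_lin_sum.
under eq_bigr => s _ do rewrite malg_lin_sum /=.
rewrite /mr_mul_perm pair_big /=.
rewrite pair_big /=.
(* Both sides are now compared at a fixed permutation [r]. *)
rewrite (exchange_big_dep predT) //= [RHS]big_mkcond; apply: eq_bigr => r _.
set w := perm_word r.
have sw : size w = (p + q)%N by rewrite size_perm_word.
have st : size (take p w) = p by rewrite size_takel // sw leq_addr.
have cC (A : {set 'I_(p + q)}) : #|A| = p -> #|~: A| = q.
  by move=> cA; rewrite cardsCs setCK card_ord cA addKn.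
have split_w (s : 'S_p) (t : 'S_q) A :
  (w == relabel s A ++ relabel t (~: A)) =
  (take p w == relabel s A) && (drop p w == relabel t (~: A)).
  by rewrite -{1}(cat_take_drop p w) eqseq_cat // size_relabel st.
case: ifP => [/andP[/eqP t1 /eqP t2]|ng]; last first.
  apply: big1 => -[[s t] A] /= /andP[/andP[/andP[/eqP P1 /eqP P2] /eqP cA]].
  rewrite split_w => /andP[/eqP e1 /eqP e2]; move: ng.
  by rewrite e1 e2 !inc_tree_relabel ?cC // P1 P2 !eqxx.
have uw : uniq (take p w ++ drop p w) by rewrite cat_take_drop uniq_perm_word.
pose A : {set 'I_(p + q)} := [set x | val x \in take p w].
have ltw x : x \in w -> (x < p + q)%N.
  by rewrite (perm_mem (perm_word_iota r)) mem_iota.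
have pA1 : perm_eq (take p w) (letters A).
  apply: uniq_perm; rewrite ?take_uniq ?letters_uniq ?uniq_perm_word // => x.
  apply/idP/mapP => [xt|[y + ->]]; last by rewrite mem_enum inE.
  by exists (Ordinal (ltw x (mem_take xt))); rewrite ?mem_enum ?inE.
have pA2 : perm_eq (drop p w) (letters (~: A)).
  move: uw; rewrite cat_uniq => /and3P[_ /hasPn hw _].
  apply: uniq_perm; rewrite ?drop_uniq ?letters_uniq ?uniq_perm_word // => x.
  apply/idP/mapP => [xd|[y + ->]].
    exists (Ordinal (ltw x (mem_drop xd))) => //.
    by rewrite mem_enum !inE; exact: hw.
  rewrite mem_enum !inE => yt.
  have : val y \in take p w ++ drop p w.
    by rewrite cat_take_drop (perm_mem (perm_word_iota r)) mem_iota /=.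
  by rewrite mem_cat (negbTE yt).
have cA : #|A| = p by rewrite -size_letters -(perm_size pA1).
have [s sE] := relabel_surj cA pA1.
have [t tE] := relabel_surj (cC _ cA) pA2.
rewrite (big_pred1 (s, t, A)) // => -[[s' t'] A'] /=; rewrite split_w.
apply/idP/eqP => [/andP[/andP[_ /eqP cA'] /andP[/eqP e1 /eqP e2]]|[-> -> ->]].
  rewrite -{}sE in e1; rewrite -{}tE in e2.
  have [-> eA] := relabel_inj cA cA' e1.
  by have [-> _] := relabel_inj (cC _ cA) (cC _ cA') e2; rewrite eA.
by rewrite sE tE -(inc_tree_relabel s cA) -(inc_tree_relabel t (cC _ cA)) sE
  tE t1 t2 cA !eqxx.
Qed.

Theorem theorem2 (F : fieldType) (k l : nat) (T1 T2 : btree)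
    (hk : (1 <= k)%N) (hl : (1 <= l)%N)
    (hT1 : nverts T1 = k) (hT2 : nverts T2 = l) :
  lr_mul << T1 >> << T2 >> =
    \sum_(C in product_tableaux (tableau_of_tree k.-1 T1)
                                (tableau_of_tree l.-1 T2))
      << tree_of_tableau C >> :> {malg F[btree]}.
Proof.
case: k l hk hl hT1 hT2 => [//|k] [//|l] _ _ hT1 hT2.
set z := (RHS); apply: Psi_star_inj; rewrite /lr_mul.
(* The sum [z] witnesses the equation defining the product, so the chosen element satisfies it too,
   and injectivity of [Psi_star] identifies the two. *)
suff e : Psi_star z = mr_mul (Psi_star << T1 >>) (Psi_star << T2 >>).
  rewrite e.
  exact: (epsilon_spec _ (fun z =>
    Psi_star z = mr_mul (Psi_star << T1 >>) (Psi_star << T2 >>))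
    (ex_intro _ z e)).
rewrite !Psi_starU (mr_mul_Psi_star F hT1 hT2).
rewrite [LHS](malg_lin_sum (Psi_star_tree F)) /=.
set P := product_tableaux _ _.
have catP C : C \in P -> catalan C by rewrite inE => /and4P[].
rewrite (eq_bigr (fun C => \sum_(s :
  'S_(k.+1 + l.+1) | Psi s == tree_of_tableau C)
    << (existT _ (k.+1 + l.+1)%N s : perms) >>)); last first.
  move=> C /catP/tree_of_tableauP[nT _]; exact: Psi_star_treeE.
rewrite (exchange_big_dep predT) //= [RHS]big_mkcond; apply: eq_bigr => r _.
have := @tableau_mem_product (perm_word r) T1 T2 k l (uniq_perm_word r)
  (size_perm_word r) hT1 hT2.
rewrite -/P -/(Psi r) => <-; set C0 := tableau_of_tree _ _.
(* Only the tableau [C0] of the tree of [r] can contribute, so [r] has coefficient 1 or 0 according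
   to whether [C0] is in [P]. *)
have E C : C \in P -> (Psi r == tree_of_tableau C) = (C == C0).
  move=> /catP/tree_of_tableauP[nT tT]; apply/eqP/eqP => [e|e].
    by rewrite -tT -e.
  apply: (tableau_of_tree_inj _ nT); first by rewrite nverts_Psi.
  by rewrite tT e.
case: ifP => C0P.
  rewrite (big_pred1 C0) // => C /=.
  case CP : (C \in P); first by rewrite E.
  by apply/esym/eqP => e; rewrite e C0P in CP.
rewrite big_pred0 // => C; case CP : (C \in P) => //=; rewrite E //.
by apply/eqP => e; rewrite -e CP in C0P.
Qed.
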